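(* Let $n \in \mathbb{N}$ and let $\theta$ be a real skew-symmetric $n \times n$-matrix. Let $(\mathcal{A}, G, \alpha)$ be a connected covering of the quantum $n$-torus $\mathbb{A}^n_\theta$. Let $(\mathcal{A}, \mathbb{R}^n, \beta)$ be the corresponding lift of the gauge action (i.e. an ergodic lift of the gauge action commuting with $\alpha$) and let $\Gamma := \ker(\beta)$. Then there is a group isomorphism $\phi: G \to \mathbb{Z}^n/\Gamma$ such that $\alpha_g = \beta_{\phi(g)}$ for all $g \in G$, where $\beta$ is regarded as an action of $\mathbb{R}^n/\Gamma$.
   Context: C*-dynamical systems. A C*-dynamical system $(\mathcal{A}, G, \alpha)$ consists of a unital C*-algebra $\mathcal{A}$, a topological group $G$ and an action of $G$ by *-automorphisms $\alpha_g$ of $\mathcal{A}$ such that $G \times \mathcal{A} \to \mathcal{A}$, $(g,a) \mapsto \alpha_g(a)$, is continuous. Its fixed point algebra is $\mathcal{A}^G = \{a : \alpha_g(a) = a \ \forall g \in G\}$; the system is ergodic if $\mathcal{A}^G = \mathbb{C}\mathbf{1}$. For compact $G$, the system is free if the map $\mathcal{A} \otimes_{\mathrm{alg}} \mathcal{A} \to C(G, \mathcal{A})$, $x \otimes y \mapsto (g \mapsto x\alpha_g(y))$, has dense range in the C*-norm (supremum norm). Covering. A covering of a unital C*-algebra $\mathcal{B}$ is a free C*-dynamical system $(\mathcal{A}, G, \alpha)$ with a finite group $G$ (not assumed Abelian) and fixed point algebra $\mathcal{B}$. Quantum tori. For a real skew-symmetric $n \times n$-matrix $\theta$, $\mathbb{A}^n_\theta$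 is the universal C*-algebra generated by unitaries $u_1, \dots, u_n$ subject to $u_k u_\ell = \exp(2\pi i \theta_{k\ell}) u_\ell u_k$ for all $1 \le k, \ell \le n$. The gauge action of $\mathbb{R}^n$ on $\mathbb{A}^n_\theta$ is $\gamma_s(u_k) := \exp(2\pi i s_k) u_k$ for $s \in \mathbb{R}^n$. Lifts and connectedness. Let $\mathcal{A}$ be a C*-algebra containing $\mathbb{A}^n_\theta$. A C*-dynamical system $(\mathcal{A}, \mathbb{R}^n, \beta)$ is a lift of the gauge action if $\Gamma := \ker\beta = \{s \in \mathbb{R}^n : \beta_s = \mathrm{id}\}$ is of maximal rank, i.e. $\mathbb{R}^n/\Gamma$ is compact, and $\beta_s(x) = \gamma_s(x)$ for all $s \in \mathbb{R}^n$ and $x \in \mathbb{A}^n_\theta$ (so $\Gamma \subseteq \mathbb{Z}^n$). A covering $(\mathcal{A}, G, \alpha)$ of $\mathbb{A}^n_\theta$ is connected if there is an ergodic lift $(\mathcal{A}, \mathbb{R}^n, \beta)$ of the gauge action such that $\alpha_g \circ \beta_s = \beta_s \circ \alpha_g$ for all $g \in G$ and $s \in \mathbb{R}^n$. *)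

(* Defs.v *)
From HB Require Import structures.
From mathcomp Require Import fingroup.
From mathcomp Require Import all_boot all_order all_algebra.
From mathcomp Require Import complex.
From mathcomp Require Import all_classical all_reals all_analysis.

Set Implicit Arguments.
Unset Strict Implicit.
Unset Printing Implicit Defensive.

Import Order.TTheory GRing.Theory Num.Theory.
Import numFieldNormedType.Exports.

Local Open Scope classical_set_scope.
Local Open Scope ring_scope.
Local Open Scope complex_scope.
Local Open Scope quotient_scope.

(* Unital C*-algebras, nonzero because [algType] requires 1 <> 0.  The norm is
   valued in [R[i]], where it is real and nonnegative.  A plain record is used
   because the hierarchy has no join of rings and normed modules that
   [numDomainType] inherits from: the two structures only meet on the concrete
   carrier [cstar_sort]. *)
Record cstarAlg (R : realType) := CStarAlg {
  cstar_base : completeNormedModType R[i];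
  cstar_mul : cstar_base -> cstar_base -> cstar_base;
  cstar_one : cstar_base;
  cstar_star : cstar_base -> cstar_base;
  cstar_mulA : associative cstar_mul;
  cstar_mul1 : left_id cstar_one cstar_mul;
  cstar_mulr1 : right_id cstar_one cstar_mul;
  cstar_mulDl : left_distributive cstar_mul +%R;
  cstar_mulDr : right_distributive cstar_mul +%R;
  cstar_scaleAl : forall (c : R[i]) (x y : cstar_base),
    c *: cstar_mul x y = cstar_mul (c *: x) y;
  cstar_scaleAr : forall (c : R[i]) (x y : cstar_base),
    c *: cstar_mul x y = cstar_mul x (c *: y);
  cstar_one_neq0 : cstar_one != 0;
  cstar_starK : involutive cstar_star;
  cstar_starD : {morph cstar_star : x y / x + y};
  cstar_starZ : forall (c : R[i]) (x : cstar_base),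
    cstar_star (c *: x) = c^* *: cstar_star x;
  cstar_starM : forall x y,
    cstar_star (cstar_mul x y) = cstar_mul (cstar_star y) (cstar_star x);
  cstar_normM : forall x y, `|cstar_mul x y| <= `|x| * `|y|;
  cstar_identity : forall x, `|cstar_mul (cstar_star x) x| = `|x| ^+ 2
}.

Definition cstar_sort (R : realType) (A : cstarAlg R) : Type := cstar_base A.
Coercion cstar_sort : cstarAlg >-> Sortclass.

Section CStarInstances.
Variables (R : realType) (A : cstarAlg R).

HB.instance Definition _ :=
  CompleteNormedModule.copy (cstar_sort A) (cstar_base A).
HB.instance Definition _ := GRing.Zmodule_isNzRing.Build (cstar_sort A)
  (@cstar_mulA R A) (@cstar_mul1 R A) (@cstar_mulr1 R A)
  (@cstar_mulDl R A) (@cstar_mulDr R A) (@cstar_one_neq0 R A).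
HB.instance Definition _ := GRing.Lmodule_isLalgebra.Build R[i] (cstar_sort A)
  (@cstar_scaleAl R A).
HB.instance Definition _ := GRing.Lalgebra_isAlgebra.Build R[i] (cstar_sort A)
  (@cstar_scaleAr R A).

End CStarInstances.

Section StarAlgebra.
Variable R : realType.
Implicit Types A B : cstarAlg R.

Definition star A : A -> A := @cstar_star R A.

Definition star_hom A B (f : A -> B) : Prop :=
  [/\ linear f, monoid_morphism f & {morph f : x / star x}].

Definition star_automorphism A (f : A -> A) : Prop := star_hom f /\ bijective f.

Definition star_subalgebra A (S : set A) : Prop :=
  [/\ S 1, forall (c : R[i]) x y, S x -> S y -> S (c *: x + y),
      forall x y, S x -> S y -> S (x * y) & forall x, S x -> S (star x)].

Definition unitary A (x : A) : Prop := star x * x = 1 /\ x * star x = 1.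

End StarAlgebra.

HB.mixin Record isTopologicalGroup G of Group G & Topological G := {
  mulg_continuous : continuous (fun p : G * G => (p.1 * p.2)%g);
  invg_continuous : continuous (fun g : G => g^-1%g)
}.

#[short(type="topGroupType")]
HB.structure Definition TopologicalGroup :=
  {G of isTopologicalGroup G & Group G & Topological G}.

(* The additive group R^n, written multiplicatively. *)
Definition vecGroup (R : realType) (n : nat) : Type := 'rV[R]_n.

Section VecGroup.
Variables (R : realType) (n : nat).

HB.instance Definition _ := Topological.copy (vecGroup R n) 'rV[R]_n.
HB.instance Definition _ :=
  Group.copy (vecGroup R n) (Algebra.to_multiplicative 'rV[R]_n).

Let mulV_continuous :
  continuous (fun p : vecGroup R n * vecGroup R n => (p.1 * p.2)%g).
Proof. exact: (@add_continuous 'rV[R]_n). Qed.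

Let invV_continuous : continuous (fun s : vecGroup R n => s^-1%g).
Proof. exact: (@opp_continuous 'rV[R]_n). Qed.

HB.instance Definition _ := isTopologicalGroup.Build (vecGroup R n)
  mulV_continuous invV_continuous.

End VecGroup.

(* A finite group carries the discrete topology. *)
Section FinDiscreteGroup.
Variable G : finGroupType.

HB.instance Definition _ := Group.copy (discrete_topology G) G.

Let mulG_continuous : continuous
  (fun p : discrete_topology G * discrete_topology G => (p.1 * p.2)%g).
Proof.
move=> p S /= Sp; exists ([set p.1], [set p.2]) => /=.
  by split; apply/principal_filterP.
by case=> g h /= [-> ->]; move/principal_filterP: Sp.
Qed.

Let invG_continuous : continuous (fun g : discrete_topology G => g^-1%g).
Proof.
by move=> g S /principal_filterP Sg; apply/principal_filterP.
Qed.

HB.instance Definition _ := isTopologicalGroup.Build (discrete_topology G)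
  mulG_continuous invG_continuous.

End FinDiscreteGroup.

Section DynamicalSystems.
Variable R : realType.
Implicit Types (A B : cstarAlg R) (G : topGroupType).

Record cstarSystem A G := CStarSystem {
  sys_act :> G -> A -> A;
  sys_act_aut : forall g, star_automorphism (sys_act g);
  sys_act1 : forall x, sys_act 1%g x = x;
  sys_actM : forall g h x, sys_act (g * h)%g x = sys_act g (sys_act h x);
  sys_act_continuous : continuous (fun p : G * A => sys_act p.1 p.2)
}.

Definition fixed_points A G (alpha : cstarSystem A G) : set A :=
  [set x | forall g, alpha g x = x].

Definition ergodic A G (alpha : cstarSystem A G) : Prop :=
  fixed_points alpha = range (fun c : R[i] => c%:A : A).

(* Density in the supremum norm of the range of the map sending
   \sum_i x_i (x) y_i to g |-> \sum_i x_i * alpha_g y_i. *)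
Definition free_system A G (alpha : cstarSystem A G) : Prop :=
  forall f : G -> A, continuous f -> forall eps : R[i], 0 < eps ->
  exists m (x y : 'I_m -> A),
    forall g, `|f g - \sum_(i < m) x i * alpha g (y i)| < eps.

(* Coverings of [B], with [B] identified with the fixed point algebra through
   the embedding [iota]. *)
Definition covering A B (G : finGroupType)
    (alpha : cstarSystem A (discrete_topology G)) (iota : B -> A) : Prop :=
  [/\ free_system alpha, star_hom iota, injective iota
    & range iota = fixed_points alpha].

End DynamicalSystems.

Section QuantumTorus.
Variables (R : realType) (n : nat).
Implicit Types A B D : cstarAlg R.

Definition expi2pi (t : R) : R[i] := cos (2 * pi * t) +i* sin (2 * pi * t).

Definition torus_relations (theta : 'M[R]_n) D (v : 'I_n -> D) : Prop :=
  (forall k, unitary (v k)) /\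
  forall k l, v k * v l = expi2pi (theta k l) *: (v l * v k).

Definition generates B (u : 'I_n -> B) : Prop :=
  forall S : set B, closed S -> star_subalgebra S -> (forall k, S (u k)) ->
  S = setT.

(* [B] is the quantum torus, with canonical generators [u]. *)
Definition quantum_torus (theta : 'M[R]_n) B (u : 'I_n -> B) : Prop :=
  [/\ torus_relations theta u, generates u
    & forall D (v : 'I_n -> D), torus_relations theta v ->
      exists f : B -> D, star_hom f /\ forall k, f (u k) = v k].

Definition gauge_action B (u : 'I_n -> B)
    (gamma : cstarSystem B (vecGroup R n)) : Prop :=
  forall (s : 'rV[R]_n) k, gamma s (u k) = expi2pi (s 0 k) *: u k.

Definition sys_ker A (beta : cstarSystem A (vecGroup R n)) : pred 'rV[R]_n :=
  fun s => `[< forall x, beta s x = x >].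

Lemma sys_ker_zmod_closed A (beta : cstarSystem A (vecGroup R n)) :
  zmod_closed (sys_ker beta).
Proof.
split=> [|s t /asboolP hs /asboolP ht]; apply/asboolP.
  exact: (sys_act1 beta).
move=> x; rewrite -{1}[x]ht -(sys_actM beta (s - t) t).
rewrite -[RHS]hs; congr (beta _ _); exact: subrK.
Qed.

HB.instance Definition _ A (beta : cstarSystem A (vecGroup R n)) :=
  GRing.isZmodClosed.Build _ (sys_ker beta) (sys_ker_zmod_closed beta).

(* R^n / Gamma, with Gamma the kernel of [beta]. *)
Definition RnMod A (beta : cstarSystem A (vecGroup R n)) : Type :=
  Quotient.quot (GRing.ZmodClosed.clone _ (sys_ker beta) _).
HB.instance Definition _ A (beta : cstarSystem A (vecGroup R n)) :=
  ZmodQuotient.on (RnMod beta).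

(* Z^n / Gamma, as a subgroup of R^n / Gamma. *)
Definition ZnMod A (beta : cstarSystem A (vecGroup R n)) : set (RnMod beta) :=
  range (fun z : 'rV[int]_n => \pi_(RnMod beta) (map_mx intr z)).

(* [beta] as an action of R^n / Gamma; by [quot_actE] it does not depend on the
   choice of representatives. *)
Definition quot_act A (beta : cstarSystem A (vecGroup R n)) (q : RnMod beta) :
  A -> A := beta (repr q).

Lemma quot_actE A (beta : cstarSystem A (vecGroup R n)) (s : 'rV[R]_n) :
  quot_act (\pi_(RnMod beta) s : RnMod beta) =1 beta s.
Proof.
move=> x; rewrite /quot_act.
have /eqP : repr (\pi_(RnMod beta) s) = s %[mod RnMod beta] by rewrite reprK.
rewrite -Quotient.idealrBE => /asboolP h.
rewrite -{1}(subrK s (repr _)) (sys_actM beta _ s); exact: h.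
Qed.

Definition gauge_lift A B (iota : B -> A) (gamma : cstarSystem B (vecGroup R n))
    (beta : cstarSystem A (vecGroup R n)) : Prop :=
  compact [set: quotient_topology (RnMod beta)] /\
  forall s x, beta s (iota x) = iota (gamma s x).

Definition connecting_lift A B (G : finGroupType)
    (alpha : cstarSystem A (discrete_topology G)) (iota : B -> A)
    (gamma : cstarSystem B (vecGroup R n))
    (beta : cstarSystem A (vecGroup R n)) : Prop :=
  [/\ gauge_lift iota gamma beta, ergodic beta
    & forall g s x, alpha g (beta s x) = beta s (alpha g x)].

Definition connected_covering A B (G : finGroupType)
    (alpha : cstarSystem A (discrete_topology G)) (iota : B -> A)
    (gamma : cstarSystem B (vecGroup R n)) : Prop :=
  covering alpha iota /\ exists beta, connecting_lift alpha iota gamma beta.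

End QuantumTorus.

Arguments ZnMod {R n A} beta _.
Arguments quot_act {R n A} beta q _.

(* Main.v *)
(* Averaging over dyadic points gives Fourier coefficients for the one-parameter
   groups of [beta] along the coordinate axes, which are periodic because
   R^n / Gamma is compact; a vector with vanishing coefficients is zero.  Hence a
   continuous linear map commuting with [beta] is the identity as soon as it
   fixes the joint eigenvectors.  By ergodicity a nonzero eigenvector is
   invertible and, up to a scalar, the only one of its weight.  With N Z^n inside
   Gamma the weights lie in N^-1 Z^n, and since the u_k supply all weights in
   Z^n, every unital endomorphism T commuting with [beta] and fixing the torus
   multiplies the eigenvectors of weight c by t(c), for a character t of the
   finite group of weights modulo Z^n.  Both alpha_g (g in G) and beta_z
   (z in (Z/N)^n) are families of such T, and both have sums whose range is fixed
   by every beta_z: for alpha because A^G is the torus.  Orthogonality of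
   characters then forces every T to belong to both families, so they are the
   same set of automorphisms; freeness makes alpha faithful. *)
Require Import Defs.
From HB Require Import structures.
From mathcomp Require Import fingroup.
From mathcomp Require Import all_boot all_order all_algebra.
From mathcomp Require Import complex.
From mathcomp Require Import all_classical all_reals all_analysis.
From mathcomp Require Import ring lra zify.

Set Implicit Arguments.
Unset Strict Implicit.
Unset Printing Implicit Defensive.

Import Order.TTheory GRing.Theory Num.Theory.
Import numFieldNormedType.Exports.

Local Open Scope classical_set_scope.
Local Open Scope ring_scope.
Local Open Scope complex_scope.
Local Open Scope quotient_scope.

(** * Dyadic means *)

Section DyadicMean.
Variables (R : realType) (V : completeNormedModType R[i]).
Implicit Types F : R -> V.

(** Left Riemann sums on [0, 1], standing in for a [V]-valued integral. Dyadic steps make the grids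
    nested, and translation by a grid point permutes the summands of a 1-periodic function. *)
Definition dyadic_mean (m : nat) F : V :=
  2 ^- m *: \sum_(0 <= j < 2 ^ m) F (j%:R / 2 ^+ m).

(** Compactness of [0, 1] in its near-covering form, along the filter of small positive [d], yields
    one modulus for all [s]; [t] may leave the interval. *)
Lemma heine_unit F : continuous F -> forall eps : R[i], 0 < eps ->
  exists2 d : R, 0 < d & forall s t, 0 <= s <= 1 -> `|t - s| < d ->
    `|F t - F s| < eps.
Proof.
move=> cF eps eps0.
have e20 : 0 < eps / 2 by rewrite divr_gt0.
have /compact_near_coveringP/(_ _ (0 : R)^'+
  (fun d s => forall t, `|t - s| < d -> `|F t - F s| < eps)) :=
  @segment_compact R 0 1.
case.
  move=> s _.
  have /cvgrPdist_lt/(_ _ e20) := cF s.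
  rewrite near_simpl => /nbhs_ballP [r /= r0 rP].
  exists (ball s (r / 2), [set d | d < r / 2]) => /=.
    split; first by apply: nbhsx_ballx; rewrite divr_gt0.
    by apply: nbhs_right_lt; rewrite divr_gt0.
  move=> [x d] /= [xs dr] t tx.
  rewrite (le_lt_trans (ler_distD (F s) _ _))// [eps]splitr ltrD//.
    rewrite distrC; apply: rP; rewrite /ball/=.
    rewrite (le_lt_trans (ler_distD x _ _))// [r]splitr ltrD//.
    by rewrite distrC (lt_trans tx).
  apply: rP; apply: lt_trans xs _.
  by rewrite ltr_pdivrMr// ltr_pMr// ltr1n.
move=> d [/= d0 H] .
have d20 : 0 < d / 2 by rewrite divr_gt0.
exists (d / 2) => // s t s01 ts; apply: (H (d / 2)) => //=.
  by rewrite sub0r normrN gtr0_norm// ltr_pdivrMr// ltr_pMr// ltr1n.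
Qed.

Lemma bounded_unit F : continuous F ->
  exists C : R, forall s, 0 <= s <= 1 -> `|F s| <= C%:C.
Proof.
move=> cF.
have /compact_near_coveringP/(_ _ \oo
  (fun n s => `|F s| <= n%:R%:C)) :=
  @segment_compact R 0 1.
case.
  move=> s _.
  have /cvgrPdist_lt/(_ _ ltr01) := cF s.
  rewrite near_simpl => Hs.
  (* The norm takes values in [R[i]], so the Archimedean bound is applied to its real part. *)
  have [n nP] : exists n : nat, `|F s| <= n%:R%:C.
    have := normr_ge0 (F s); case: (`|F s|) => a b.
    rewrite lecE/= => /andP[/eqP b0 a0].
    exists (Num.bound a); rewrite lecE/= b0 eqxx/= ltW//.
    by apply: le_lt_trans (archi_boundP a0).
  exists ([set x | `|F s - F x| < 1], [set k | (n.+1 <= k)%N]) => /=.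
    by split => //; exists n.+1.
  move=> [x k] /= [xs nk].
  have -> : F x = F s - (F s - F x) by rewrite subKr.
  rewrite (le_trans (ler_normB _ _))//.
  have : (n.+1%:R : R)%:C <= (k%:R)%:C by rewrite lecR ler_nat.
  apply: le_trans; rewrite -natr1 rmorphD/= lerD// ltW//.
move=> n _ H; exists n%:R => s; exact: (H n (leqnn n)).
Qed.

Lemma half_pow_gt0 (K : numFieldType) m : 0 < 2 ^- m :> K.
Proof. by rewrite invr_gt0 exprn_gt0. Qed.

Lemma le_dyadic_sum m (f : nat -> V) (g : nat -> R[i]) :
  (forall j, (j < 2 ^ m)%N -> `|f j| <= g j) ->
  `|2 ^- m *: \sum_(0 <= j < 2 ^ m) f j| <= 2 ^- m * \sum_(0 <= j < 2 ^ m) g j.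
Proof.
move=> H; rewrite normrZ (gtr0_norm (half_pow_gt0 _ m)).
rewrite ler_pM2l ?half_pow_gt0//.
apply: le_trans (ler_norm_sum _ _ _) _; rewrite !big_mkord.
by apply: ler_sum => i _; exact: H.
Qed.

Lemma dyadic_sum_cst m (c : R[i]) : 2 ^- m * \sum_(0 <= j < 2 ^ m) c = c.
Proof.
rewrite big_const_nat subn0 iter_addr_0 -[c *+ _]mulr_natr natrX mulrCA.
by rewrite mulVf ?mulr1// expf_neq0.
Qed.

(** Each coarse cell contains [2 ^ d] fine grid points, all at distance less than [2 ^- m] from its
    left end; the value there is compared with the average over the cell. *)
Lemma dyadic_mean_refine F (eps : R[i]) m d :
  (forall s t, 0 <= s <= 1 -> `|t - s| < 2 ^- m -> `|F t - F s| <= eps) ->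
  `|dyadic_mean m F - dyadic_mean (m + d) F| <= eps.
Proof.
move=> H; rewrite /dyadic_mean expnD big_nat_mul/=.
have -> : 2 ^- (m + d) = 2 ^- m * 2 ^- d :> R[i] by rewrite exprD invfM.
rewrite -scalerA [2 ^- d *: _]scaler_sumr -scalerBr -sumrB.
rewrite -[leRHS](dyadic_sum_cst m); apply: le_dyadic_sum => j jm.
have -> : F (j%:R / 2 ^+ m) = 2 ^- d *: \sum_(0 <= i < 2 ^ d) F (j%:R / 2 ^+ m).
  rewrite big_const_nat subn0 iter_addr_0 -[_ *+ (2 ^ d)]scaler_nat scalerA.
  by rewrite natrX mulVf ?scale1r ?expf_neq0.
rewrite -{1}[(j * 2 ^ d)%N]add0n big_addn mulSn addnK -scalerBr -sumrB.
rewrite -[leRHS](dyadic_sum_cst d); apply: le_dyadic_sum => i id_.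
rewrite distrC; apply: H.
  rewrite divr_ge0 ?exprn_ge0//= ler_pdivrMr ?exprn_gt0// mul1r -natrX ler_nat.
  exact: ltnW.
have -> : (i + j * 2 ^ d)%:R / 2 ^+ (m + d) - j%:R / 2 ^+ m
    = 2 ^- m * (i%:R / 2 ^+ d) :> R.
  by rewrite natrD natrM natrX exprD; field; rewrite !expf_neq0.
rewrite ger0_norm ?mulr_ge0 ?invr_ge0 ?exprn_ge0//.
rewrite -[ltRHS]mulr1 ltr_pM2l ?half_pow_gt0// ltr_pdivrMr ?exprn_gt0//.
by rewrite mul1r -natrX ltr_nat.
Qed.

Lemma half_pow_small (d : R) : 0 < d -> \forall m \near \oo, 2 ^- m < d.
Proof.
move=> d0.
have /cvgrPdist_lt/(_ _ d0) : (GRing.exp (2^-1) : R ^nat) @ \oo --> (0 : R).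
  by apply: cvg_expr; rewrite ger0_norm ?invr_ge0// invf_lt1// ltr1n.
apply: filterS => m; rewrite sub0r normrN exprVn gtr0_norm//.
Qed.

Lemma dyadic_mean_cvg F : continuous F ->
  exists l : V, dyadic_mean m F @[m --> \oo] --> l.
Proof.
move=> cF; apply/cvg_ex/cauchy_cvgP/cauchyP => eps eps0.
have e20 : 0 < eps / 2 by rewrite divr_gt0.
have [d d0 Fd] := heine_unit cF e20.
have [N _ NP] := half_pow_small d0.
exists (dyadic_mean N F); exists N => // m /= /subnKC <-; rewrite -ball_normE/=.
apply: (@le_lt_trans _ _ (eps / 2)).
  apply: dyadic_mean_refine => s t s01 st; apply/ltW/Fd => //.
  by rewrite (lt_trans st)//; exact: (NP N (leqnn N)).
by rewrite ltr_pdivrMr// ltr_pMr// ltr1n.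
Qed.

Lemma dyadic_meanD m F1 F2 :
  dyadic_mean m (fun s => F1 s + F2 s) = dyadic_mean m F1 + dyadic_mean m F2.
Proof. by rewrite /dyadic_mean big_split scalerDr. Qed.

Lemma dyadic_meanZ m (a : R[i]) F :
  dyadic_mean m (fun s => a *: F s) = a *: dyadic_mean m F.
Proof. by rewrite /dyadic_mean -scaler_sumr scalerA mulrC -scalerA. Qed.

Lemma dyadic_mean_ext m F1 F2 :
  F1 =1 F2 -> dyadic_mean m F1 = dyadic_mean m F2.
Proof. by move=> eqF; rewrite /dyadic_mean; under eq_bigr do rewrite eqF. Qed.

End DyadicMean.

(** * Uniqueness of Fourier coefficients *)

Section Exp.
Variable R : realType.

Lemma expi2piD (a b : R) : expi2pi (a + b) = expi2pi a * expi2pi b.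
Proof.
rewrite /expi2pi mulrDr cosD sinD; simpc.
by rewrite [X in _ +i* X]addrC.
Qed.

Lemma expi2pi0 : expi2pi 0 = 1 :> R[i].
Proof. by rewrite /expi2pi mulr0 cos0 sin0. Qed.

Lemma expi2pi_conj (a : R) : (expi2pi a)^* = expi2pi (- a).
Proof. by rewrite /expi2pi mulrN cosN sinN. Qed.

Lemma norm_expi2pi (a : R) : `|expi2pi a| = 1.
Proof. by rewrite normc_def /= cos2Dsin2 sqrtr1. Qed.

Lemma expi2pi_nat (n : nat) : expi2pi n%:R = 1 :> R[i].
Proof.
elim: n => [|n IHn]; first exact: expi2pi0.
rewrite -natr1 expi2piD IHn mul1r /expi2pi mulr1.
by rewrite mulr_natl cos2pi sin2pi.
Qed.

Lemma expi2pi_int (k : int) : expi2pi k%:~R = 1 :> R[i].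
Proof.
case: k => n; first exact: expi2pi_nat.
by rewrite NegzE rmorphN /= -expi2pi_conj expi2pi_nat conjc1.
Qed.

Lemma cos_2pi_lt (a b : R) : 0 <= a -> a < b -> b <= 2^-1 ->
  cos (2 * pi * b) < cos (2 * pi * a).
Proof.
move=> a0 ab b2; have pi0 := pi_gt0 R.
have pi20 : 0 < 2 * pi :> R by rewrite mulr_gt0.
have bpi : 2 * pi * b <= pi.
  by rewrite mulrAC -[leRHS]mul1r ler_pM2r// mulrC -ler_pdivlMr// div1r.
have ab' : 2 * pi * a < 2 * pi * b by rewrite ltr_pM2l.
have a20 : 0 <= 2 * pi * a by rewrite mulr_ge0// ltW.
rewrite ltr_cos// in_itv/= ?a20 ?bpi ?andbT; first exact: le_trans (ltW ab') bpi.
exact: le_trans a20 (ltW ab').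
Qed.

Lemma cos_2pi1B (a : R) : cos (2 * pi * (1 - a)) = cos (2 * pi * a).
Proof.
by rewrite mulrBr mulr1 addrC mulr_natl cosD2pi cosN.
Qed.

(** After subtracting the floor, the cosine decides: it is strictly decreasing on the first half
    period and symmetric under [b |-> 1 - b], so on [0, 1) it equals 1 only at 0. *)
Lemma expi2pi_eq1 (a : R) : expi2pi a = 1 -> exists k : int, a = k%:~R.
Proof.
move=> ea1; exists (Num.floor a).
have := floor_le a; have := floorD1_gt a.
set k := (Num.floor a)%:~R => ak ka.
have : expi2pi (a - k) = 1.
  by rewrite expi2piD ea1 -rmorphN/= expi2pi_int mulr1.
have : 0 <= a - k < 1.
  by rewrite subr_ge0 ka ltrBlDl; move: ak; rewrite rmorphD.
move: (a - k) (subrK k a) => b <- /andP[b0 b1] [cb1 _].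
suff -> : b = 0 by rewrite add0r.
apply/eqP; rewrite eq_le b0 andbT leNgt; apply/negP => b_gt0.
have [b2|b2] := leP b 2^-1.
  by have := cos_2pi_lt (lexx 0) b_gt0 b2; rewrite cb1 mulr0 cos0 ltxx.
have := @cos_2pi_lt 0 (1 - b) (lexx 0).
rewrite subr_gt0 cos_2pi1B cb1 mulr0 cos0 ltxx => /(_ b1) F.
suff : false by []; apply: F; lra.
Qed.

Lemma norm_complex_le (a b : R) : `|a +i* b| <= (`|a| + `|b|)%:C.
Proof.
rewrite normc_def lecR/= -(ler_pXn2r (n:=2))// ?nnegrE ?sqrtr_ge0 ?addr_ge0//.
rewrite sqr_sqrtr ?addr_ge0 ?sqr_ge0// sqrrD !real_normK ?num_real//.
by rewrite addrAC lerDl mulrn_wge0// mulr_ge0.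
Qed.

Lemma expi2pi_cvg (k s : R) (eps : R[i]) : 0 < eps ->
  \forall t \near s, `|expi2pi (k * s) - expi2pi (k * t)| < eps.
Proof.
move=> eps0.
have [d d0 ->] : exists2 d : R, 0 < d & eps = (d + d)%:C.
  case: eps eps0 => a b; rewrite ltcE/= => /andP[/eqP-> a0].
  by exists (a / 2); rewrite ?divr_gt0// -splitr.
have cc (f : R -> R) : continuous f ->
    \forall t \near s, `|f (2 * pi * (k * s)) - f (2 * pi * (k * t))| < d.
  move=> cf; have c2 : continuous (fun t : R => f (2 * pi * (k * t))).
    move=> t; apply: (@continuous_comp _ _ _ (fun t => 2 * pi * (k * t)) f);
      last exact: cf.
    by apply: (@continuous_comp _ _ _ ( *%R k) ( *%R (2 * pi)));
      exact: mulrl_continuous.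
  by have /cvgrPdist_lt/(_ _ d0) := c2 s.
apply: filterS2 (cc _ (@continuous_cos R)) (cc _ (@continuous_sin R)) => t ct st.
by apply: le_lt_trans (norm_complex_le _ _) _; rewrite ltcR ltrD.
Qed.

End Exp.

(** * Twisted functions and a kernel concentrated at the integers *)

Section Twist.
Variables (R : realType) (V : completeNormedModType R[i]).

Definition twist (a : R) (F : R -> V) : R -> V := fun s => expi2pi (a * s) *: F s.

Lemma twist_continuous a (F : R -> V) : continuous F -> continuous (twist a F).
Proof.
move=> cF s; apply/cvgrPdist_lt => eps eps0.
have e20 : 0 < eps / 2 by rewrite divr_gt0.
have Fs0 : 0 < `|F s| + 1 by rewrite ltr_wpDl.
have e3 : 0 < eps / 2 / (`|F s| + 1) by rewrite divr_gt0.
have /cvgrPdist_lt/(_ _ e20) := cF s.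
apply: filterS2 (expi2pi_cvg a s e3) => t et ft.
rewrite /twist (le_lt_trans (ler_distD (expi2pi (a * t) *: F s) _ _))//.
rewrite -scalerBl -scalerBr !normrZ norm_expi2pi mul1r [eps]splitr ltr_leD ?ltW//.
rewrite ltr_pdivlMr// in et; apply: le_lt_trans et.
by rewrite ler_wpM2l// lerDl.
Qed.

(** This is $\cos^2(\pi s)$: nonnegative, maximal exactly at the integers, with frequencies -1, 0
    and 1 only. *)
Definition cos_kernel (s : R) : R := (1 + cos (2 * pi * s)) / 2.

Lemma cos_kernelE s :
  (cos_kernel s)%:C = (2 + expi2pi s + expi2pi (- s)) / 4 :> R[i].
Proof.
apply/eqP; rewrite eq_complex /= /expi2pi mulrN cosN sinN.
simpc; rewrite andbT /cos_kernel; apply/eqP; by field.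
Qed.

Lemma cos_kernel_ge0 s : 0 <= cos_kernel s.
Proof.
by rewrite /cos_kernel divr_ge0// -(subrr 1) -[1 - 1]addrC addrC lerD2r ?cos_geN1.
Qed.

Lemma cos_kernel_lt s t :
  0 <= s -> s < t -> t <= 2^-1 -> cos_kernel t < cos_kernel s.
Proof.
by move=> s0 st t2; rewrite ltr_pM2r ?invr_gt0// ltrD2l cos_2pi_lt.
Qed.

Lemma cos_kernel1B s : cos_kernel (1 - s) = cos_kernel s.
Proof. by rewrite /cos_kernel cos_2pi1B. Qed.

(** One factor of the kernel mixes the frequencies [k], [k + 1] and [k - 1], hence the induction on
    [M] for all [k] at once. *)
Lemma cos_kernel_sum_cvg0 (F : R -> V) M :
  (forall k : int, dyadic_mean m (twist k%:~R F) @[m --> \oo] --> (0 : V)) ->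
  forall k : int,
    dyadic_mean m (fun s => (cos_kernel s)%:C ^+ M *: twist k%:~R F s)
      @[m --> \oo] --> (0 : V).
Proof.
move=> F0; elim: M => [|M IHM] k.
  have := F0 k; apply: cvg_trans; apply: near_eq_cvg; apply: nearW => m.
  by apply: dyadic_mean_ext => s; rewrite expr0 scale1r.
have H : forall m,
  dyadic_mean m (fun s => (cos_kernel s)%:C ^+ M.+1 *: twist k%:~R F s) =
  4^-1 *: (2 *: dyadic_mean m (fun s => (cos_kernel s)%:C ^+ M *: twist k%:~R F s) +
  dyadic_mean m (fun s => (cos_kernel s)%:C ^+ M *: twist (k + 1)%:~R F s) +
  dyadic_mean m (fun s => (cos_kernel s)%:C ^+ M *: twist (k - 1)%:~R F s)).
  move=> m; rewrite -!dyadic_meanZ -!dyadic_meanD -dyadic_meanZ.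
  apply: dyadic_mean_ext => s; rewrite /twist !scalerA -!scalerDl scalerA.
  congr (_ *: _); rewrite exprSr cos_kernelE !rmorphD/= rmorphN/= !mulrDl mulN1r.
  by rewrite !mul1r !expi2piD; field.
set D := (fun k m =>
  dyadic_mean m (fun s => (cos_kernel s)%:C ^+ M *: twist k%:~R F s)) in IHM H.
have L : 4^-1 *: (2 *: D k m + D (k + 1) m + D (k - 1) m) @[m --> \oo]
    --> (4^-1 *: (2 *: 0 + 0 + 0) : V).
  apply: (@cvgZr); apply: (@cvgD); last exact: IHM.
  by apply: (@cvgD); last exact: IHM; apply: (@cvgZr); exact: IHM.
rewrite scaler0 !addr0 scaler0 in L.
by apply: cvg_trans L; apply: near_eq_cvg; apply: nearW => m; rewrite -H.
Qed.

(** Only the [2 ^ d] grid points below [a / 2] are kept; there the kernel is at least its value at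
    [a / 2], and the discarded terms are nonnegative. *)
Lemma cos_kernel_mean_ge (a : R) r d M : a = 2 ^- r -> a <= 2^-1 ->
  2 ^- r.+1 * (cos_kernel (a / 2))%:C ^+ M <=
  2 ^- (r.+1 + d) * \sum_(0 <= j < 2 ^ (r.+1 + d))
     (cos_kernel (j%:R / 2 ^+ (r.+1 + d)))%:C ^+ M.
Proof.
move=> ar a2.
have a0 : 0 < a by rewrite ar half_pow_gt0.
have le2 : (2 ^ d <= 2 ^ (r.+1 + d))%N by rewrite leq_pexp2l// leq_addl.
rewrite exprD invfM -mulrA ler_pM2l ?half_pow_gt0//.
rewrite -[leLHS](dyadic_sum_cst d) ler_pM2l ?half_pow_gt0//.
rewrite (big_cat_nat (leq0n _) le2)//= -[leLHS]addr0 lerD//; last first.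
  by apply: sumr_ge0 => j _; rewrite exprn_ge0// lecR cos_kernel_ge0.
rewrite !big_mkord; apply: ler_sum => j _.
rewrite lerXn2r ?nnegrE ?lecR ?cos_kernel_ge0//.
have : (j%:R / 2 ^+ (r.+1 + d)) <= a / 2.
  rewrite ar -invfM -exprSr exprD invfM mulrCA ger_pMr ?half_pow_gt0//.
  by rewrite ler_pdivrMr ?exprn_gt0// mul1r -natrX ler_nat ltnW.
rewrite le_eqVlt => /predU1P[->//|jlt]; apply/ltW/cos_kernel_lt => //.
lra.
Qed.

(* Trigonometric polynomials concentrated near the integers, here the powers of
   [(1 + cos (2 pi s)) / 2], recover [F 0]. *)
Lemma dyadic_mean_unique (F : R -> V) : continuous F -> F 1 = F 0 ->
  (forall k : int, dyadic_mean m (twist k%:~R F) @[m --> \oo] --> (0 : V)) ->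
  F 0 = 0.
Proof.
move=> cF F1 F0; apply: contrapT => /eqP; rewrite -normr_gt0 => nF0.
pose eps := `|F 0| / 2.
have eps0 : 0 < eps by rewrite divr_gt0.
have [del del0 delP] := heine_unit cF eps0.
have [C CP] := bounded_unit cF.
have [r [rdel r2]] : exists r, 2 ^- r < del /\ 2 ^- r <= 2^-1 :> R.
  have [N _ NP] := half_pow_small del0.
  exists N.+1; split; first exact: (NP N.+1 (leqnSn N)).
  rewrite exprS invfM ger_pMr ?invr_gt0//.
  by rewrite invf_le1 ?exprn_gt0// exprn_ege1// ler1n.
pose a : R := 2 ^- r.
have a0 : 0 < a by exact: half_pow_gt0.
(* On [[a], [1 - a]] the kernel is at most [q], while on [0, [a / 2]] it is at least [q'], which is
   strictly larger. *)
pose q := cos_kernel a; pose q' := cos_kernel (a / 2).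
have q0 : 0 <= q by exact: cos_kernel_ge0.
have qq' : q < q'.
  by rewrite cos_kernel_lt ?divr_ge0 ?(ltW a0)// ltr_pdivrMr// ltr_pMr// ltr1n.
have q'0 : 0 < q' by exact: le_lt_trans qq'.
have C0 : 0 <= C.
  by rewrite -lecR; apply: le_trans (CP 0 _); rewrite ?normr_ge0 ?lexx ?ler01.
have qMC M : (q ^+ M * (C + C))%:C = q%:C ^+ M * (C%:C + C%:C).
  by rewrite rmorphM/= rmorphXn rmorphD.
(* Within [a] of 0 or 1 the first term suffices, by uniform continuity and [F 1 = F 0]; in the
   middle the second term does. *)
have far s : 0 <= s <= 1 -> forall M,
  `|(cos_kernel s)%:C ^+ M *: (F s - F 0)| <=
    (cos_kernel s)%:C ^+ M * eps + (q ^+ M * (C + C))%:C.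
  move=> s01 M.
  have kM : 0 <= (cos_kernel s)%:C ^+ M by rewrite exprn_ge0// lecR cos_kernel_ge0.
  have qM : 0 <= q ^+ M * (C + C) by rewrite mulr_ge0 ?addr_ge0 ?exprn_ge0.
  rewrite normrZ ger0_norm//.
  have [sa|sa] := ltP s a.
    rewrite -[leLHS]addr0 lerD ?lecR// ler_wpM2l// ltW// delP ?lexx ?ler01//.
    by rewrite subr0 ger0_norm ?(lt_trans sa)//; case/andP: s01.
  have [sa'|sa'] := ltP (1 - a) s.
    rewrite -[leLHS]addr0 lerD ?lecR// ler_wpM2l// ltW// -F1 delP ?lexx ?ler01//.
    rewrite distrC ger0_norm ?subr_ge0; last by case/andP: s01.
    by apply: lt_trans rdel; rewrite -/a; lra.
  rewrite -[leLHS]add0r lerD// ?mulr_ge0 ?(ltW eps0)//. rewrite qMC ler_pM//.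
    rewrite lerXn2r ?nnegrE ?lecR ?cos_kernel_ge0// /q.
    have [s2|s2] := leP s 2^-1.
      move: sa; rewrite le_eqVlt => /predU1P[->//|sa].
      by apply/ltW/cos_kernel_lt => //; exact: ltW.
    rewrite -[cos_kernel s]cos_kernel1B.
    have : a <= 1 - s by lra.
    rewrite le_eqVlt => /predU1P[->//|as1]; apply/ltW/cos_kernel_lt => //; lra.
  rewrite (le_trans (ler_normB _ _))// lerD// CP ?lexx ?ler01//.
(* For fixed [M] the weighted means [D] of [F] tend to 0, while [D] differs from [S *: F 0] by at
   most [S * eps] plus the middle error. As [F 0] has norm [2 * eps], one [S * eps] survives, and
   [S] is bounded below independently of the grid. *)
have main M : 2 ^- r.+1 * (q'%:C ^+ M) * eps <= (q ^+ M * (C + C))%:C.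
  apply/ler_addgt0Pr => e e0.
  have /cvgrPdist_lt/(_ _ e0) := cos_kernel_sum_cvg0 M F0 0.
  move=> [N _ NP].
  have := NP (r.+1 + N)%N (leq_addl _ _); rewrite /= sub0r normrN.
  have := cos_kernel_mean_ge N M erefl r2.
  set m := (r.+1 + N)%N; set S := 2 ^- m * _ => SP.
  set D := dyadic_mean _ _ => De.
  have DE : D =
    S *: F 0 + dyadic_mean m (fun s => (cos_kernel s)%:C ^+ M *: (F s - F 0)).
    rewrite /S -scalerA scaler_suml -scalerDr -big_split/=.
    congr (_ *: _); apply: eq_bigr => j _.
    by rewrite /twist mul0r expi2pi0 scale1r -scalerDr addrC subrK.
  have S0 : 0 <= S.
    apply: le_trans SP; rewrite mulr_ge0 ?(ltW (half_pow_gt0 _ _))//.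
    by rewrite exprn_ge0// lecR cos_kernel_ge0.
  have D2 : `|dyadic_mean m (fun s => (cos_kernel s)%:C ^+ M *: (F s - F 0))| <=
      S * eps + (q ^+ M * (C + C))%:C.
    apply: le_trans (le_dyadic_sum (g := fun j =>
      (cos_kernel (j%:R / 2 ^+ m))%:C ^+ M * eps + (q ^+ M * (C + C))%:C) _) _.
      move=> j jm; apply: far.
      rewrite divr_ge0 ?exprn_ge0//= ler_pdivrMr ?exprn_gt0// mul1r -natrX ler_nat.
      exact: ltnW.
    by rewrite big_split/= mulrDr dyadic_sum_cst -mulr_suml mulrA.
  have : S * `|F 0| <= e + (S * eps + (q ^+ M * (C + C))%:C).
    have -> : S * `|F 0| = `|S *: F 0| by rewrite normrZ ger0_norm.
    have -> : S *: F 0 = D - (D - S *: F 0) by rewrite subKr.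
    rewrite (le_trans (ler_normB _ _))// lerD ?(ltW De)//.
    by rewrite {1}DE addrAC subrr add0r.
  have -> : `|F 0| = eps + eps by rewrite /eps -splitr.
  rewrite mulrDr addrCA lerD2l => H.
  rewrite addrC; apply: le_trans H; rewrite ler_pM2r//.
have [e [e0 ee]] : exists e : R, 0 < e /\ eps = e%:C.
  move: eps0; case: (eps) => x y; rewrite ltcE/= => /andP[/eqP-> x0].
  by exists x.
have main2 M : 2 ^- r.+1 * e <= (q / q') ^+ M * (C + C).
  have E : 2 ^- r.+1 * q'%:C ^+ M * e%:C = (2 ^- r.+1 * q' ^+ M * e)%:C.
    move: (q') => w.
    by rewrite !rmorphM/= fmorphV/= !rmorphXn/= rmorph_nat.
  have := main M; rewrite ee E lecR => H.
  by rewrite expr_div_n mulrAC ler_pdivlMr ?exprn_gt0// mulrAC.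
(* Dividing by [q' ^+ M] leaves a fixed positive number below a geometric sequence tending to 0. *)
have : `|q / q'| < 1.
  by rewrite ger0_norm ?divr_ge0// ?(ltW q'0)// ltr_pdivrMr// mul1r.
move=> /cvg_expr /cvgrPdist_lt H.
have e1 : 0 < 2 ^- r.+1 * e by rewrite mulr_gt0// half_pow_gt0.
have e2 : 0 < 2 ^- r.+1 * e / (C + C + 1) by rewrite divr_gt0// ltr_wpDl ?addr_ge0.
have [N _ /(_ N (leqnn N))/=] := H _ e2.
rewrite sub0r normrN ger0_norm ?exprn_ge0 ?divr_ge0 ?(ltW q'0)//.
rewrite ltr_pdivlMr ?ltr_wpDl ?addr_ge0//.
rewrite ltNge => /negP; apply.
apply: le_trans (main2 N) _.
rewrite ler_wpM2l ?lerDl// exprn_ge0// divr_ge0// ltW//.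
Qed.
End Twist.

(** * Periodic flows *)

Section Linear.
Variables (K : pzRingType) (V W : lmodType K) (f : V -> W) (flin : linear f).

Lemma linear_fun0 : f 0 = 0.
Proof. by have := flin (-1) 0 0; rewrite scaler0 addr0 scaleN1r addNr. Qed.

Lemma linear_funD x y : f (x + y) = f x + f y.
Proof. by have := flin 1 x y; rewrite !scale1r. Qed.

Lemma linear_funZ a x : f (a *: x) = a *: f x.
Proof. by have := flin a x 0; rewrite linear_fun0 !addr0. Qed.

Lemma linear_funB x y : f (x - y) = f x - f y.
Proof. by rewrite linear_funD -scaleN1r linear_funZ scaleN1r. Qed.

Lemma linear_fun_sum (I : Type) (r : seq I) (P : pred I) (g : I -> V) :
  f (\sum_(i <- r | P i) g i) = \sum_(i <- r | P i) f (g i).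
Proof. exact: (big_morph f linear_funD linear_fun0). Qed.

End Linear.

Section PeriodicFlow.
Variables (R : realType) (V : completeNormedModType R[i]).
Variables (U : R -> V -> V).
Hypothesis U0 : forall x, U 0 x = x.
Hypothesis UD : forall s t x, U (s + t) x = U s (U t x).
Hypothesis U1 : forall x, U 1 x = x.
Hypothesis Ulin : forall s, linear (U s).
Hypothesis Uc : continuous (fun p : R * V => U p.1 p.2).

Lemma flow_continuous x : continuous (U ^~ x).
Proof.
move=> s; apply: (@continuous_comp _ _ _ (fun s => (s, x))
  (fun p : R * V => U p.1 p.2)).
  apply: (@cvg_pair _ _ _ (nbhs s) (nbhs s) (nbhs x) _ _ _ id (cst x));
    [exact: cvg_id | exact: cvg_cst].
exact: Uc.
Qed.

Lemma linear_fun_mean (S : V -> V) : linear S ->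
  (forall s x, S (U s x) = U s (S x)) ->
  forall m a x, S (dyadic_mean m (twist a (U ^~ x))) =
    dyadic_mean m (twist a (U ^~ (S x))).
Proof.
move=> Slin SU m a x; rewrite /dyadic_mean linear_funZ// linear_fun_sum//.
by congr (_ *: _); apply: eq_bigr => j _; rewrite /twist linear_funZ// SU.
Qed.

(** Already at level [m] the mean is an exact eigenvector for grid translations: a step of [2 ^- m]
    shifts the summands cyclically, the last one wrapping around because the flow has period 1 and
    [k] is an integer. *)
Lemma flow_mean m (k : int) x j :
  U (j%:R / 2 ^+ m) (dyadic_mean m (twist (- k%:~R) (U ^~ x))) =
  expi2pi (k%:~R * (j%:R / 2 ^+ m)) *: dyadic_mean m (twist (- k%:~R) (U ^~ x)).
Proof.
elim: j => [|j IHj]; first by rewrite mul0r mulr0 expi2pi0 scale1r U0.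
rewrite -natr1 mulrDl UD.
set h : R := 1 / 2 ^+ m.
have -> : U h (dyadic_mean m (twist (- k%:~R) (U ^~ x)))
    = expi2pi (k%:~R * h) *: dyadic_mean m (twist (- k%:~R) (U ^~ x)).
  rewrite {1}/dyadic_mean linear_funZ// linear_fun_sum// -dyadic_meanZ.
  congr (_ *: _).
  pose g i := twist (- k%:~R) (U ^~ x) (i%:R / 2 ^+ m).
  transitivity (\sum_(0 <= i < 2 ^ m) expi2pi (k%:~R * h) *: g i.+1).
    apply: eq_bigr => i _; rewrite /g /twist linear_funZ// -UD scalerA -expi2piD.
    rewrite -[i.+1]addn1 natrD mulrDl -/h addrC. by congr (expi2pi _ *: _); ring.
  rewrite -!scaler_sumr; congr (_ *: _).
  have g2 : g (2 ^ m)%N = g 0.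
    rewrite /g /twist natrX mulfV ?expf_neq0// mul0r U1 mulr1 mulr0 expi2pi0 U0.
    by rewrite -rmorphN/= expi2pi_int.
  case: (2 ^ m)%N g2 (expn_gt0 2 m) => // n' g2 _.
  by rewrite big_nat_recr//= big_nat_recl//= g2 addrC.
by rewrite linear_funZ// IHj scalerA -expi2piD mulrDr addrC.
Qed.

Lemma expi2piZ_cvg (k s : R) (l : V) (t : nat -> R) (x : nat -> V) :
  t @ \oo --> s -> x @ \oo --> l ->
  expi2pi (k * t m) *: x m @[m --> \oo] --> expi2pi (k * s) *: l.
Proof.
move=> ts /cvgrPdist_lt xl; apply/cvgrPdist_lt => eps eps0.
have e20 : 0 < eps / 2 by rewrite divr_gt0.
have l0 : 0 < `|l| + 1 by rewrite ltr_wpDl.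
have e3 : 0 < eps / 2 / (`|l| + 1) by rewrite divr_gt0.
have et : \forall m \near \oo,
  `|expi2pi (k * s) - expi2pi (k * t m)| < eps / 2 / (`|l| + 1).
  exact: ts (expi2pi_cvg k s e3).
have := xl _ e20; move: et; apply: filterS2 => m etm xm.
rewrite (le_lt_trans (ler_distD (expi2pi (k * t m) *: l) _ _))//.
rewrite -scalerBl -scalerBr !normrZ norm_expi2pi mul1r [eps]splitr ltr_leD ?ltW//.
rewrite ltr_pdivlMr// in etm; apply: le_lt_trans etm.
by rewrite ler_wpM2l// lerDl.
Qed.

Lemma fourier_coef (k : int) x : exists2 l : V,
  dyadic_mean m (twist (- k%:~R) (U ^~ x)) @[m --> \oo] --> l &
  forall s, U s l = expi2pi (k%:~R * s) *: l.
Proof.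
have [l xl] :=
  dyadic_mean_cvg (twist_continuous (a := - k%:~R) (@flow_continuous x)).
exists l => //.
(* The approximation [t m] of [s] lies on the same grid as the mean of level [m], so [flow_mean]
   applies for every [m] and joint continuity passes to the limit. *)
have pos (s : R) : 0 <= s -> U s l = expi2pi (k%:~R * s) *: l.
  move=> s0; pose t m : R := (Num.truncn (s * 2 ^+ m))%:R / 2 ^+ m.
  have ts : t @ \oo --> s.
    apply/cvgrPdist_lt => eps eps0; apply: filterS (half_pow_small eps0) => m.
    apply: le_lt_trans; rewrite -[s in s - _](mulfK (x := 2 ^+ m)) ?expf_neq0//.
    rewrite /t -mulrBl normrM [X in _ * X]ger0_norm ?invr_ge0 ?exprn_ge0//.
    rewrite ler_piMl ?invr_ge0 ?exprn_ge0//.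
    have /andP[t1 t2] := truncn_itv (mulr_ge0 s0 (exprn_ge0 m (ler0n R 2))).
    by rewrite ger0_norm ?subr_ge0// lerBlDl ltW// natr1.
  have L1 : U (t m) (dyadic_mean m (twist (- k%:~R) (U ^~ x))) @[m --> \oo]
      --> U s l.
    have C : (t m, dyadic_mean m (twist (- k%:~R) (U ^~ x))) @[m --> \oo]
        --> (s, l).
      exact: (@cvg_pair _ _ _ \oo (nbhs s) (nbhs l) _ _ _ t _ ts xl).
    exact: (continuous_cvg _ (@Uc (s, l)) C).
  have L2 := expi2piZ_cvg (k := k%:~R) ts xl.
  apply: (cvg_unique _ L1); first exact: norm_hausdorff.
  by apply: cvg_trans L2; apply: near_eq_cvg; apply: nearW => m;
    rewrite /t flow_mean.
move=> s; have [s0|s0] := leP 0 s; first exact: pos.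
have := pos (- s); rewrite oppr_ge0 => /(_ (ltW s0)) /(congr1 (U s)).
rewrite -UD subrr U0 linear_funZ// => H.
by rewrite [in RHS]H scalerA -expi2piD mulrN subrr expi2pi0 scale1r.
Qed.

(** If [D] killed all Fourier coefficients of [x], those of [D x] would vanish and [D x] would be 0.
    The last clause says that the coefficient [y] inherits eigenvalue relations of [x], so that
    coordinates can be treated one after another. *)
Lemma fourier_step (D : V -> V) x : linear D -> continuous D ->
  (forall s z, D (U s z) = U s (D z)) -> D x != 0 ->
  exists (k : int) (y : V), [/\ D y != 0,
   forall s, U s y = expi2pi (k%:~R * s) *: y &
   forall (S : V -> V) c, linear S -> continuous S ->
    (forall s z, S (U s z) = U s (S z)) -> S x = c *: x -> S y = c *: y].
Proof.
move=> Dlin Dc DU; apply: contraNP => nex; apply/eqP.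
have HD : U 0 (D x) = 0; last by rewrite U0 in HD.
apply: (dyadic_mean_unique (@flow_continuous (D x))); first by rewrite U0 U1.
move=> k; have [l xl Ul] := fourier_coef (- k) x.
rewrite rmorphN opprK/= in xl.
have : D (dyadic_mean m (twist k%:~R (U ^~ x))) @[m --> \oo] --> D l.
  exact: continuous_cvg (Dc l) xl.
under eq_fun do rewrite linear_fun_mean//.
suff /eqP-> : D l == 0 by [].
apply: contra_notT nex => Dl; exists (- k), l; split => // S c Slin Sc SU Sx.
have L1 : S (dyadic_mean m (twist k%:~R (U ^~ x))) @[m --> \oo] --> S l.
  exact: continuous_cvg (Sc l) xl.
have L2 : c *: (dyadic_mean m (twist k%:~R (U ^~ x))) @[m --> \oo] --> c *: l.
  exact: cvgZr.
apply: (cvg_unique _ L1); first exact: norm_hausdorff.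
apply: cvg_trans L2; apply: near_eq_cvg; apply: nearW => m.
rewrite (linear_fun_mean Slin SU) Sx -dyadic_meanZ; apply: dyadic_mean_ext => s.
by rewrite /twist (linear_funZ (Ulin s)) !scalerA mulrC.
Qed.

End PeriodicFlow.

(** * Joint eigenvectors *)

Section Systems.
Variables (R : realType) (A : cstarAlg R).

Lemma sys_linear (G : topGroupType) (alpha : cstarSystem A G) g : linear (alpha g).
Proof. by case: (sys_act_aut alpha g) => [[]]. Qed.

Lemma sys_continuous (G : topGroupType) (alpha : cstarSystem A G) g :
  continuous (alpha g).
Proof.
move=> x; apply: (@continuous_comp _ _ _ (fun x => (g, x))
  (fun p : G * A => alpha p.1 p.2)).
  by apply: (@cvg_pair _ _ _ (nbhs x) (nbhs g) (nbhs x) _ _ _ (cst g) id);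
    [exact: cvg_cst | exact: cvg_id].
exact: sys_act_continuous.
Qed.

Lemma star0 : star (0 : A) = 0.
Proof.
have := @cstar_starD R A 0 0; rewrite addr0 => /eqP.
by rewrite eq_sym -subr_eq0 addrK => /eqP.
Qed.

Lemma starM (x y : A) : star (x * y) = star y * star x.
Proof. exact: cstar_starM. Qed.

Lemma starKA (x : A) : star (star x) = x.
Proof. exact: cstar_starK. Qed.

Lemma starZ (c : R[i]) (x : A) : star (c *: x) = c^* *: star x.
Proof. exact: cstar_starZ. Qed.

Lemma star_mul_neq0 (x : A) : x != 0 -> star x * x != 0.
Proof.
move=> x0; rewrite -normr_eq0.
have -> : `|star x * x| = `|x| ^+ 2 by exact: cstar_identity.
by rewrite expf_neq0// normr_eq0.
Qed.

Lemma star_neq0 (x : A) : x != 0 -> star x != 0.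
Proof. by apply: contraNneq => x0; rewrite -(starKA x) x0 star0. Qed.
End Systems.

Section Eigen.
Variables (R : realType) (n : nat) (A : cstarAlg R).
Variable beta : cstarSystem A (vecGroup R n).

Lemma sysD (s t : 'rV[R]_n) x : beta (s + t) x = beta s (beta t x).
Proof. exact: (sys_actM beta). Qed.

Lemma sys0 x : beta (0 : 'rV[R]_n) x = x.
Proof. exact: (sys_act1 beta). Qed.

Variable N : nat.
Hypothesis N1 : (1 < N)%N.

Let N0 : N%:R != 0 :> R.
Proof. by rewrite pnatr_eq0 -lt0n ltnW. Qed.

(* The integer vector [k] stands for the weight [k / N]. *)
Definition weight (k : 'rV[int]_n) (s : 'rV[R]_n) : R :=
  \sum_j (k 0 j)%:~R * (s 0 j / N%:R).

Definition eigenvector (k : 'rV[int]_n) (x : A) : Prop :=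
  forall s : 'rV[R]_n, beta s x = expi2pi (weight k s) *: x.

Lemma weightD k l s : weight (k + l) s = weight k s + weight l s.
Proof.
by rewrite /weight -big_split/=; apply: eq_bigr => j _; rewrite mxE rmorphD mulrDl.
Qed.

Lemma weightN k s : weight (- k) s = - weight k s.
Proof.
by rewrite /weight -sumrN; apply: eq_bigr => j _; rewrite mxE rmorphN mulNr.
Qed.

Lemma weight_delta k j t : weight k (t *: delta_mx 0 j) = (k 0 j)%:~R * (t / N%:R).
Proof.
rewrite /weight (bigD1 j)//= !mxE !eqxx mulr1 big1 ?addr0// => i /negPf ij.
by rewrite !mxE ij andbF mulr0 mul0r mulr0.
Qed.

Lemma eigenvectorM k l x y :
  eigenvector k x -> eigenvector l y -> eigenvector (k + l) (x * y).
Proof.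
move=> kx ly s; have [[_ [_ bM] _] _] := sys_act_aut beta s.
by rewrite bM kx ly weightD expi2piD -scalerAl -scalerAr scalerA.
Qed.

Lemma eigenvector_star k x : eigenvector k x -> eigenvector (- k) (star x).
Proof.
move=> kx s; have [[_ _ bS] _] := sys_act_aut beta s.
by rewrite bS kx starZ weightN -expi2pi_conj.
Qed.

Lemma eigenvector_fixed x : eigenvector 0 x <-> fixed_points beta x.
Proof.
have w0 s : weight 0 s = 0.
  by rewrite /weight big1// => j _; rewrite mxE mul0r.
split=> [x0 s|x0 s]; first by rewrite (x0 s) w0 expi2pi0 scale1r.
by rewrite w0 expi2pi0 scale1r (x0 s).
Qed.

Section Existence.
Hypothesis period : forall j x, beta (N%:R *: delta_mx 0 j : 'rV[R]_n) x = x.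
Variable D : A -> A.
Hypotheses (Dlin : linear D) (Dc : continuous D).
Hypothesis Dbeta : forall (s : 'rV[R]_n) x, D (beta s x) = beta s (D x).

Lemma partial_eigenvector_exists x (l : seq 'I_n) : D x != 0 ->
  exists y (k : 'I_n -> int), D y != 0 /\ forall i, i \in l -> forall t : R,
    beta ((t * N%:R) *: delta_mx 0 i : 'rV[R]_n) y = expi2pi ((k i)%:~R * t) *: y.
Proof.
move=> Dx; elim: l => [|j l [y [k [Dy ky]]]]; first by exists x, (fun=> 0).
(* Time is rescaled by [N], so that the period becomes 1. The relations already obtained on [l]
   survive because these flows commute. *)
pose U t := beta ((t * N%:R) *: delta_mx 0 j : 'rV[R]_n) : A -> A.
have Ubeta (s : 'rV[R]_n) t z : beta s (U t z) = U t (beta s z).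
  by rewrite /U -!sysD addrC.
have [||||||q [z [Dz Uz zP]]] := @fourier_step R A U _ _ _ _ _ D y Dlin Dc _ Dy.
- by move=> z; rewrite /U mul0r scale0r sys0.
- by move=> s t z; rewrite /U mulrDl scalerDl sysD.
- by move=> z; rewrite /U mul1r period.
- by move=> s; exact: sys_linear.
- move=> p; apply: (@continuous_comp _ _ _
    (fun p : R * A => ((p.1 * N%:R) *: delta_mx 0 j : vecGroup R n, p.2))
    (fun p : vecGroup R n * A => beta p.1 p.2)); last exact: sys_act_continuous.
  have c1 : continuous (fun t : R => (t * N%:R) *: delta_mx 0 j : 'rV[R]_n).
    move=> t; rewrite /continuous_at; apply: cvgZr_tmp; apply: cvgMr_tmp; exact: cvg_id.
  apply: (@cvg_pair _ _ _ (nbhs p)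
    (nbhs ((p.1 * N%:R) *: delta_mx 0 j : 'rV[R]_n)) (nbhs p.2)).
    exact: (continuous_cvg _ (@c1 p.1) (@cvg_fst _ _ _ _ _)).
  exact: cvg_snd.
- by move=> s z; exact: Dbeta.
exists z, (fun i => if i == j then q else k i); split => // i.
rewrite inE; case: eqVneq => [-> _ t|ij /= il t]; first exact: Uz.
apply: zP; [exact: sys_linear|exact: sys_continuous| |exact: ky].
by move=> s w; exact: Ubeta.
Qed.

Lemma eigenvector_exists x : D x != 0 ->
  exists k y, D y != 0 /\ eigenvector k y.
Proof.
move=> /partial_eigenvector_exists H; have [y [k [Dy ky]]] := H (index_enum 'I_n).
exists (\row_i k i), y; split => // s.
rewrite [s in LHS]row_sum_delta /weight.
elim/big_rec2: _ => [|i a b _ IH]; first by rewrite sys0 expi2pi0 scale1r.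
rewrite sysD IH linear_funZ; last exact: sys_linear.
have := ky i (mem_index_enum _) (s 0 i / N%:R); rewrite divfK// => ->.
by rewrite scalerA -expi2piD mxE addrC.
Qed.
End Existence.
End Eigen.

(** * Periods from compactness *)

Section Period.
Variables (R : realType) (n : nat) (A : cstarAlg R).
Variable beta : cstarSystem A (vecGroup R n).

Lemma pi_eqP (s t : 'rV[R]_n) :
  \pi_(RnMod beta) s = \pi_(RnMod beta) t <-> forall x, beta (s - t) x = x.
Proof.
split=> [/eqP|H]; first by rewrite -Quotient.idealrBE => /asboolP.
by apply/eqP; rewrite -Quotient.idealrBE; apply/asboolP.
Qed.

Hypothesis compact_quot : compact [set: quotient_topology (RnMod beta)].
Hypothesis ker_int : forall s : 'rV[R]_n, (forall x, beta s x = x) ->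
  forall j, exists k : int, s 0 j = k%:~R.

(** The classes of the multiples [t e_j] have a cluster point in the compact quotient. Two multiples
    near it differ, up to an element of the kernel, by a vector with entries of modulus below 1;
    this vector is integral, hence 0. *)
Lemma period_coordinate j : exists2 p : nat, (0 < p)%N &
  forall x, beta (p%:R *: delta_mx 0 j : 'rV[R]_n) x = x.
Proof.
pose q (t : nat) : quotient_topology (RnMod beta) :=
  \pi_(RnMod beta) (t%:R *: delta_mx 0 j : 'rV[R]_n).
have [|c [_ cP]] := compact_quot (F := q @ \oo); first exact: filterT.
pose s0 : 'rV[R]_n := repr (c : RnMod beta).
(* The neighbourhood is saturated under the kernel: it is the preimage of [W], which is therefore
   open in the quotient topology. *)
pose near0 (v : 'rV[R]_n) := exists2 g : 'rV[R]_n, (forall x, beta g x = x) &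
  forall i, ball (s0 0 i + g 0 i) 2^-1 (v 0 i).
pose W : set (quotient_topology (RnMod beta)) :=
  [set z | near0 (repr (z : RnMod beta))].
have reprW (v : 'rV[R]_n) : W (\pi_(RnMod beta) v) <-> near0 v.
  have rv : forall x, beta (repr (\pi_(RnMod beta) v) - v) x = x.
    by apply/pi_eqP; rewrite reprK.
  have vr : forall x, beta (v - repr (\pi_(RnMod beta) v)) x = x.
    by apply/pi_eqP; rewrite reprK.
  split=> -[g g0 gP].
    exists (g + (v - repr (\pi_(RnMod beta) v))) => [x|i].
      by rewrite sysD vr g0.
    have := gP i; rewrite /ball/= !mxE; congr (`|_| < _); ring.
  exists (g + (repr (\pi_(RnMod beta) v) - v)) => [x|i].
    by rewrite sysD rv g0.
  have := gP i; rewrite /ball/= !mxE; congr (`|_| < _); ring.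
have Wc : nbhs c W.
  apply: open_nbhs_nbhs; split.
    suff : open near0.
      by congr open; apply/seteqP; split=> v /=; rewrite -reprW.
    rewrite openE => v [g g0 gP].
    exists (fun _ i => ball (s0 0 i + g 0 i) 2^-1) => [i k|w wP].
      by rewrite (ord1 i); apply: open_nbhs_nbhs; split;
        [exact: ball_open|exact: gP].
    by exists g => // i; exact: wP.
  exists 0 => [x|i]; first exact: sys0.
  by rewrite mxE addr0; apply: ballxx.
have next (m : nat) : exists2 t, (m <= t)%N & near0 (t%:R *: delta_mx 0 j).
  have [|z [[t mt <-] /reprW Wz]] := cP (q @` [set t | (m <= t)%N]) W _ Wc.
    by exists m => // t mt; exists t.
  by exists t.
have [t _ [g g0 gP]] := next 0%N.
have [t' tt' [g' g'0 g'P]] := next t.+1.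
exists (t' - t)%N => [|x]; first by rewrite subn_gt0.
suff -> : (t' - t)%:R *: delta_mx 0 j = g' - g :> 'rV[R]_n.
  by rewrite -[in LHS](g0 x) -sysD subrK g'0.
apply/rowP => i.
have [a ga] := ker_int g0 i; have [b gb] := ker_int g'0 i.
have := gP i; have := g'P i; rewrite /ball/= !mxE eqxx/= ga gb.
have [z ->] : exists z : int, (i == j)%:R = z%:~R :> R.
  by exists (i == j)%:R; rewrite rmorph_nat.
move=> H1 H2.
have H : `|(((t' - t)%:R * z - (b - a) : int))%:~R : R| < 1.
  rewrite natrB ?(ltnW tt')// 2!rmorphB rmorphM rmorphB !rmorph_nat/=.
  move: H1 H2; set x1 := s0 0 i; move: (z%:~R) (a%:~R) (b%:~R) => z' a' b' H1 H2.
  have -> : (t'%:R - t%:R) * z' - (b' - a') =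
    (x1 + a' - t%:R * z') - (x1 + b' - t'%:R * z') by ring.
  by apply: le_lt_trans (ler_normB _ _) _; rewrite [ltRHS]splitr div1r ltrD.
move: H; rewrite -intr_norm -[1]/(1%:~R) ltr_int => H.
have /eqP : (t' - t)%:R * z - (b - a) = 0 :> int.
  by apply/eqP; rewrite -normr_eq0; lia.
rewrite subr_eq0 => /eqP /(congr1 (fun u : int => u%:~R : R)).
by rewrite rmorphM rmorphB rmorph_nat.
Qed.

Lemma period_exists : exists2 N : nat, (1 < N)%N &
  forall j x, beta (N%:R *: delta_mx 0 j : 'rV[R]_n) x = x.
Proof.
have /choice [p pP] : forall j, exists p : nat, (0 < p)%N /\
    forall x, beta (p%:R *: delta_mx 0 j : 'rV[R]_n) x = x.
  by move=> j; have [p] := period_coordinate j; exists p.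
(* The factor 2 forces [1 < N], so that ['Z_N] really is the ring of integers modulo [N]. *)
exists (2 * \prod_j p j)%N => [|j x].
  have : (0 < \prod_j p j)%N by rewrite prodn_gt0// => j; exact: (pP j).1.
  lia.
have [m ->] : exists m, (2 * \prod_j p j)%N = (m * p j)%N.
  by rewrite (bigD1 j)//= mulnCA mulnC; eexists.
elim: m => [|m IH]; first by rewrite mul0n scale0r sys0.
by rewrite mulSn natrD scalerDl sysD IH (pP j).2.
Qed.
End Period.

(** * Characters of the group of weights *)

Section Characters.
Variables (R : realType) (n : nat) (A : cstarAlg R).
Variable beta : cstarSystem A (vecGroup R n).
Variables (N : nat) (B0 : set A).
Hypothesis N1 : (1 < N)%N.
Hypothesis period : forall j x, beta (N%:R *: delta_mx 0 j : 'rV[R]_n) x = x.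
Hypothesis beta_ergodic : ergodic beta.
Hypothesis B0_weights : forall l : 'rV[int]_n,
  exists w, [/\ B0 w, w != 0 & eigenvector beta N (N%:Z *: l) w].

Let eig := eigenvector beta N.

(** The properties shared by the [alpha g] and by [beta] at integer vectors, with [B0] in the role
    of the torus inside [A]. *)
Definition module_hom (T : A -> A) : Prop :=
  [/\ linear T, monoid_morphism T, continuous T,
      forall (s : 'rV[R]_n) x, T (beta s x) = beta s (T x)
    & forall x, B0 x -> T x = x].

Lemma module_hom_comp S T : module_hom S -> module_hom T -> module_hom (S \o T).
Proof.
move=> [Sl [S1 SM] Sc Sb S0] [Tl [T1 TM] Tc Tb T0]; split.
- by move=> a x y; rewrite /= Tl Sl.
- by split => [|x y]; rewrite /= ?T1 ?S1 ?TM ?SM.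
- by move=> x; apply: continuous_comp; [exact: Tc|exact: Sc].
- by move=> s x; rewrite /= Tb Sb.
- by move=> x x0; rewrite /= T0 ?S0.
Qed.

Lemma eigenvector0 x : eig 0 x -> exists c : R[i], x = c *: 1.
Proof.
move=> /eigenvector_fixed; rewrite beta_ergodic => -[c _ <-].
by exists c.
Qed.

(** [x * star x] has weight 0, so it is a scalar by ergodicity, and it is nonzero by the
    C*-identity. *)
Lemma eigenvector_unit k x : eig k x -> x != 0 ->
  exists2 c : R[i], c != 0 & x * star x = c *: 1.
Proof.
move=> kx x0; have [|c xc] := @eigenvector0 (x * star x).
  by rewrite -(subrr k); apply: eigenvectorM => //; exact: eigenvector_star.
exists c => //; apply: contraTneq (star_mul_neq0 (star_neq0 x0)) => c0.
by rewrite starKA xc c0 scale0r eqxx.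
Qed.

(** [star x * y] has weight 0, hence is a scalar; multiplying by [x] on the left recovers a nonzero
    multiple of [y]. *)
Lemma eigenvector_line k x y : eig k x -> x != 0 -> eig k y ->
  exists c : R[i], y = c *: x.
Proof.
move=> kx x0 ky; have [|d yd] := @eigenvector0 (star x * y).
  by rewrite -(addNr k); apply: eigenvectorM => //; exact: eigenvector_star.
have [c c0 xc] := eigenvector_unit kx x0; exists (c^-1 * d).
rewrite -scalerA -[x in RHS]mulr1 scalerAr -yd mulrA xc -scalerAl mul1r.
by rewrite scalerA mulVf// scale1r.
Qed.

Lemma eigenvectorM_neq0 k x y : eig k x -> x != 0 -> y != 0 -> y * x != 0.
Proof.
move=> kx x0; apply: contraNneq => yx0; have [c c0 xc] := eigenvector_unit kx x0.
apply/eqP; rewrite -[y]mulr1 -[1 in LHS](scalerK c0) -xc -scalerAr mulrA yx0 mul0r.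
exact: scaler0.
Qed.

Lemma eigenvectorMI k w x y : eig k w -> w != 0 -> x * w = y * w -> x = y.
Proof.
move=> kw w0 /eqP; rewrite -subr_eq0 -mulrBl => xyw; apply/eqP; rewrite -subr_eq0.
by apply: contraTT xyw; exact: eigenvectorM_neq0 kw w0.
Qed.

(** Since [k] stands for the weight [k / N], this is the weight modulo $\mathbb{Z}^n$. *)
Definition weight_class (k : 'rV[int]_n) : 'rV['Z_N]_n := map_mx intr k.

Lemma weight_classD k l : weight_class (k + l) = weight_class k + weight_class l.
Proof. exact: map_mxD. Qed.

Lemma weight_classN k : weight_class (- k) = - weight_class k.
Proof. exact: map_mxN. Qed.

Lemma intr_Zp_eq0 (z : int) : z%:~R = 0 :> 'Z_N -> exists m : int, z = N%:Z * m.
Proof.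
move=> z0; exists (z %/ N)%Z; rewrite mulrC.
have zm := divz_eq z N; suff r0 : (z %% N)%Z = 0 by rewrite {1}zm r0 addr0.
have r_ge0 : (0 <= z %% N)%Z by apply: modz_ge0; lia.
have r_lt : (z %% N < N)%Z by apply: ltz_pmod; lia.
move: z0; rewrite {1}zm rmorphD rmorphM/= -[X in _ * X]/(N%:R).
rewrite pchar_Zp// mulr0 add0r.
case: (z %% N)%Z r_ge0 r_lt => // r _ rN /(congr1 val).
by rewrite /= val_Zp_nat// modn_small => [->|]; lia.
Qed.

Lemma weight_class_eq0 k : weight_class k = 0 -> exists l, k = N%:Z *: l.
Proof.
move=> /rowP k0.
have /choice [l lP] : forall j, exists m : int, k 0 j = N%:Z * m.
  by move=> j; apply: intr_Zp_eq0; have := k0 j; rewrite !mxE.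
by exists (\row_j l j); apply/rowP => j; rewrite !mxE lP.
Qed.

(** [T] preserves each eigenspace, which is at most a line. Two weights of one class differ by the
    weight of a nonzero [w] in [B0]; as [T] fixes [w], multiplication by [w] carries the scalar from
    one to the other. *)
Lemma module_hom_scalar T : module_hom T -> exists t : 'rV['Z_N]_n -> R[i],
  forall k x, eig k x -> T x = t (weight_class k) *: x.
Proof.
move=> [Tl [T1 TM] Tc Tb T0].
have Teig k x : eig k x -> eig k (T x).
  by move=> kx s; rewrite -Tb kx linear_funZ.
suff /choice [t tP] : forall c, exists a : R[i], forall k x,
    weight_class k = c -> eig k x -> T x = a *: x.
  by exists t => k x; exact: tP.
move=> c.
have [[k0 [x0 [k0c k0x x00]]]|nex] := pselect
  (exists k x, [/\ weight_class k = c, eig k x & x != 0]); last first.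
  (* A class without nonzero eigenvectors gets the default scalar 0. *)
  exists 0 => k x kc kx; rewrite scale0r; suff -> : x = 0 by rewrite linear_fun0.
  by apply: contrapT => /eqP x0; apply: nex; exists k, x.
have [a Tx0] := eigenvector_line k0x x00 (Teig _ _ k0x).
exists a => k x kc kx.
have [|l kl] := @weight_class_eq0 (k0 - k).
  by rewrite weight_classD weight_classN k0c kc subrr.
have [w [Bw w0 lw]] := B0_weights l; rewrite -kl in lw.
have [d xw] : exists d : R[i], x * w = d *: x0.
  apply: (eigenvector_line k0x x00).
  by have := eigenvectorM kx lw; rewrite addrC subrK.
apply: (eigenvectorMI lw w0).
rewrite -[w in LHS]T0// -TM xw linear_funZ// Tx0 scalerA mulrC -scalerA -xw.
exact: scalerAl.
Qed.

(** These classes form a subgroup, on which the scalars of a [module_hom] form a character. *)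
Definition occurs (c : 'rV['Z_N]_n) : bool :=
  `[< exists k x, [/\ weight_class k = c, eig k x & x != 0] >].

Lemma occursP k x : eig k x -> x != 0 -> occurs (weight_class k).
Proof. by move=> kx x0; apply/asboolP; exists k, x. Qed.

Lemma occursN c : occurs c -> occurs (- c).
Proof.
move=> /asboolP[k [x [<- kx x0]]]; rewrite -weight_classN.
by apply: occursP (eigenvector_star kx) (star_neq0 x0).
Qed.

Lemma occursD c d : occurs c -> occurs d -> occurs (c + d).
Proof.
move=> /asboolP[k [x [<- kx x0]]] /asboolP[l [y [<- ly y0]]].
rewrite -weight_classD; apply: occursP (eigenvectorM kx ly) _.
exact: eigenvectorM_neq0 ly y0 x0.
Qed.

Lemma occursDr c d : occurs c -> occurs (d + c) = occurs d.
Proof.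
move=> oc; apply/idP/idP => od; last exact: occursD.
by rewrite -(addrK c d); apply: occursD => //; exact: occursN.
Qed.

Lemma eigenvector1 : eig 0 1.
Proof.
by apply/eigenvector_fixed => s; have [[_ [b1 _] _] _] := sys_act_aut beta s.
Qed.

Lemma occurs0 : occurs 0.
Proof.
have -> : 0 = weight_class 0 by apply/rowP => j; rewrite !mxE.
exact: occursP eigenvector1 (oner_neq0 _).
Qed.

Section Scalars.
Variables (T : A -> A) (t : 'rV['Z_N]_n -> R[i]).
Hypothesis Thom : module_hom T.
Hypothesis tP : forall k x, eig k x -> T x = t (weight_class k) *: x.

Lemma scaler_injl (x : A) (a b : R[i]) : x != 0 -> a *: x = b *: x -> a = b.
Proof.
move=> x0 /eqP; rewrite -subr_eq0 -scalerBl scaler_eq0 (negPf x0) orbF subr_eq0.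
by move/eqP.
Qed.

Lemma scalar0 : t 0 = 1.
Proof.
have [_ [T1 _] _ _ _] := Thom.
have := tP eigenvector1; rewrite T1 -[1 in LHS]scale1r.
move=> /(scaler_injl (oner_neq0 _)) ->.
by congr t; apply/rowP => j; rewrite !mxE.
Qed.

Lemma scalarD c d : occurs c -> occurs d -> t (c + d) = t c * t d.
Proof.
have [_ [_ TM] _ _ _] := Thom.
move=> /asboolP[k [x [<- kx x0]]] /asboolP[l [y [<- ly y0]]].
have := tP (eigenvectorM kx ly); rewrite TM (tP kx) (tP ly) weight_classD.
rewrite -scalerAl -scalerAr scalerA => /scaler_injl -> //.
exact: eigenvectorM_neq0 ly y0 x0.
Qed.

(** Translating the summation index by [c] multiplies the sum by [t c]. *)
Lemma scalar_sum c : occurs c -> t c != 1 -> \sum_(d | occurs d) t d = 0.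
Proof.
move=> oc tc1; have : \sum_(d | occurs d) t d = (\sum_(d | occurs d) t d) * t c.
  rewrite {1}(reindex_inj (addIr c))/= mulr_suml.
  by apply: eq_big => d; rewrite occursDr// => od; rewrite scalarD.
move=> /eqP; rewrite -subr_eq0 -{1}[\sum_(_ | _) _]mulr1 -mulrBr mulf_eq0 subr_eq0.
by rewrite [1 == _]eq_sym (negPf tc1) orbF => /eqP.
Qed.
End Scalars.

(* If [T \o S i <> id] for all [i], then each character [c |-> t c * r i c] of
   the finite group of occurring weight classes is nontrivial, hence sums to
   zero; but summing over [i] first leaves only [c = 0], which contributes the
   number of indices. *)
Lemma module_hom_inverse (I : finType) (i0 : I) (S : I -> A -> A) (T : A -> A) :
  (forall i, module_hom (S i)) ->
  (forall v j, beta (delta_mx 0 j : 'rV[R]_n) (\sum_i S i v) = \sum_i S i v) ->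
  module_hom T -> exists i, forall x, T (S i x) = x.
Proof.
move=> Shom Sfix Thom; apply: contrapT => nex.
have [t tP] := module_hom_scalar Thom.
have /choice [r rP] : forall i, exists r : 'rV['Z_N]_n -> R[i],
    forall k x, eig k x -> S i x = r (weight_class k) *: x.
  by move=> i; exact: module_hom_scalar.
have sum0 i : \sum_(c | occurs c) t c * r i c = 0.
  have TS : module_hom (T \o S i) by exact: module_hom_comp.
  have trP k x : eig k x ->
      (T \o S i) x = (t (weight_class k) * r i (weight_class k)) *: x.
    have [Tl _ _ _ _] := Thom.
    by move=> kx; rewrite /= (rP i k x kx) linear_funZ// (tP k x kx) scalerA mulrC.
  have [x Dx] : exists x, T (S i x) - x != 0.
    apply: contrapT => nx; apply: nex; exists i => x; apply/eqP; rewrite -subr_eq0.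
    by apply/negPn/negP => Dx; apply: nx; exists x.
  have [TSl _ TSc TSb _] := TS.
  (* Fourier analysis of the difference with the identity produces an eigenvector moved by
     [T \o S i]; its class is one where the character is not 1. *)
  have [||s z|k [y [Dy ky]]] := @eigenvector_exists _ _ _ _ _ N1 period
    (fun x => T (S i x) - x) _ _ _ x Dx.
  - by move=> a u v; have /= -> := TSl a u v; rewrite scalerBr opprD addrACA.
  - by move=> u; apply: continuousB; [exact: TSc|exact: cvg_id].
  - by have /= -> := TSb s z; rewrite linear_funB//; exact: sys_linear.
  apply: (scalar_sum TS trP (occursP ky _)).
    by apply: contraNneq Dy => ->; rewrite subr0; exact/eqP/(linear_fun0 TSl).
  apply: contraNneq Dy => tr1; have /= -> := trP k y ky.
  by rewrite tr1 scale1r subrr.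
have : \sum_i \sum_(c | occurs c) t c * r i c = 0 by rewrite big1.
rewrite exchange_big (bigD1 0 occurs0)/= [X in _ + X]big1 ?addr0.
  rewrite (eq_bigr (fun=> 1)) => [/eqP|i _]; last first.
    by rewrite (scalar0 Thom tP) (scalar0 (Shom i) (rP i)) mulr1.
  rewrite sumr_const pnatr_eq0 cardE.
  by have := mem_enum I i0; case: (enum I).
move=> c /andP[/asboolP[k [x [kc kx x0]]] c0].
(* The sum of the [S i x] is fixed by [beta] at each unit vector, yet has the weight of [x]; where
   [c] has a nonzero entry the eigenvalue is not 1, so the sum vanishes. *)
rewrite -mulr_sumr; suff -> : \sum_i r i c = 0 by rewrite mulr0.
have Sx : \sum_i S i x = (\sum_i r i c) *: x.
  by rewrite scaler_suml; apply: eq_bigr => i _; rewrite (rP i k x kx) kc.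
have [j cj] : exists j, c 0 j != 0.
  apply: contrapT => nj; case/eqP: c0; apply/rowP => j; rewrite mxE.
  by apply: contrapT => /eqP cj; apply: nj; exists j.
have := Sfix x j; rewrite Sx linear_funZ; last exact: sys_linear.
have := kx (delta_mx 0 j); rewrite -[delta_mx 0 j]scale1r weight_delta// => ->.
rewrite scalerA => /(scaler_injl x0) /eqP.
rewrite -subr_eq0 -{2}[\sum_i _]mulr1 -mulrBr mulf_eq0 => /orP[/eqP //|].
rewrite subr_eq0 => /eqP /expi2pi_eq1[m km].
case/eqP: cj; rewrite -kc mxE.
have N0 : N%:R != 0 :> R by rewrite pnatr_eq0; lia.
suff -> : k 0 j = N%:Z * m.
  by rewrite rmorphM/= -[X in X * _]/(N%:R) pchar_Zp// mul0r.
apply/eqP; rewrite -(eqr_int R) rmorphM/= -km div1r mulrCA mulfV//.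
by rewrite mulr1.
Qed.

End Characters.

(** * The torus and the covering group *)

Lemma sys_invK (R : realType) (A : cstarAlg R) (G : topGroupType)
  (alpha : cstarSystem A G) g x : alpha g^-1%g (alpha g x) = x.
Proof. by rewrite -sys_actM mulVg sys_act1. Qed.

(** Freeness approximates the indicator function of [g] within 1/2. If [g] and [h] acted alike, one
    element [w] would be at distance less than 1/2 from both 1 and 0, although 1 has norm 1. *)
Lemma free_faithful (R : realType) (A : cstarAlg R) (G : finGroupType)
    (alpha : cstarSystem A (discrete_topology G)) (g h : G) : free_system alpha ->
  (forall x, alpha g x = alpha h x) -> g = h.
Proof.
move=> alpha_free ghE; apply: contrapT => /eqP gh.
pose f (k : discrete_topology G) : A := if (k : G) == g then 1 else 0.
have fc : continuous f.
  move=> k S fkS; apply/principal_filterP; exact: nbhs_singleton fkS.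
have half0 : 0 < 2^-1 :> R[i] by rewrite invr_gt0.
have [m [x [y fP]]] := alpha_free f fc _ half0.
have := fP g; have := fP h; rewrite /f eqxx eq_sym (negPf gh) sub0r normrN.
under eq_bigr do rewrite -ghE; set w := \sum_(i < m) _ => w0 w1.
have norm1 : `|1 : A| = 1.
  have n0 : `|1 : A| != 0 by rewrite normr_eq0 oner_neq0.
  have : `|star (1 : A) * 1| = `|1 : A| ^+ 2 by exact: cstar_identity.
  have -> : star (1 : A) * 1 = 1.
    by rewrite -{2}(starKA (1 : A)) -starM mulr1 starKA.
  by move=> H; apply: (mulfI n0); rewrite mulr1 -expr2.
have : `|1 : A| < 1.
  rewrite -[1 in ltLHS](subrK w) (le_lt_trans (ler_normD _ _))//.
  by rewrite [ltRHS]splitr div1r ltrD.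
by rewrite norm1 ltxx.
Qed.

Section FixedTorus.
Variables (R : realType) (n : nat) (B : cstarAlg R) (u : 'I_n -> B).
Variable gamma : cstarSystem B (vecGroup R n).
Hypotheses (u_gen : generates u) (gammaP : gauge_action u gamma).

(** The fixed points form a closed star-subalgebra containing the generators. *)
Lemma gauge_action_int (z : 'rV[int]_n) x : gamma (map_mx intr z : 'rV[R]_n) x = x.
Proof.
set s : vecGroup R n := map_mx intr z.
suff: [set x | gamma s x = x] = setT by move/seteqP => [_ /(_ x I)].
have [[glin [g1 gM] gS] _] := sys_act_aut gamma s.
apply: u_gen => [||k].
- have -> : [set x | gamma s x = x] = (fun x => gamma s x - x) @^-1` [set 0].
    apply/seteqP; split=> y /=; first by move=> ->; rewrite subrr.
    by move/eqP; rewrite subr_eq0 => /eqP.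
  apply: closed_comp; last first.
    by apply: accessible_closed_set1; apply: hausdorff_accessible;
      exact: norm_hausdorff.
  move=> y _; apply: continuousB; [exact: sys_continuous|exact: cvg_id].
- split=> [|c y y' /= gy gy'|y y' /= gy gy'|y /= gy]; first exact: g1.
  + by rewrite glin gy gy'.
  + by rewrite gM gy gy'.
  + by rewrite gS gy.
- by rewrite /= gammaP mxE expi2pi_int scale1r.
Qed.
End FixedTorus.

(** * Integral weights in the torus and integer translations modulo [N] *)

Section Weights.
Variables (R : realType) (n : nat) (A : cstarAlg R).
Variable beta : cstarSystem A (vecGroup R n).
Variable N : nat.
Hypothesis N1 : (1 < N)%N.
Hypothesis beta_ergodic : ergodic beta.

(** Monomials in the [v k] and their adjoints realize every integral weight; they stay nonzero
    because nonzero eigenvectors are invertible. *)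
Lemma eigenvector_generated (S : set A) (v : 'I_n -> A) :
  S 1 -> (forall x y, S x -> S y -> S (x * y)) -> (forall x, S x -> S (star x)) ->
  (forall k, S (v k)) -> (forall k, v k != 0) ->
  (forall (s : 'rV[R]_n) k, beta s (v k) = expi2pi (s 0 k) *: v k) ->
  forall l : 'rV[int]_n,
    exists w, [/\ S w, w != 0 & eigenvector beta N (N%:Z *: l) w].
Proof.
move=> S1 SM SS Sv v0 bv.
pose P (l : 'rV[int]_n) :=
  exists w, [/\ S w, w != 0 & eigenvector beta N (N%:Z *: l) w].
have P0 : P 0.
  by exists 1; split=> //; [exact: oner_neq0|rewrite scaler0; exact: eigenvector1].
have PD l l' : P l -> P l' -> P (l + l').
  move=> [w [Sw w0 lw]] [w' [Sw' w'0 lw']]; exists (w * w').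
    split; first exact: SM.
    exact: (eigenvectorM_neq0 beta_ergodic lw' w'0 w0).
  by rewrite scalerDr; apply: eigenvectorM.
have PN l : P l -> P (- l).
  move=> [w [Sw w0 lw]]; exists (star w); split; [exact: SS|exact: star_neq0|].
  by rewrite scalerN; apply: eigenvector_star.
have Pdelta j : P (delta_mx 0 j).
  exists (v j); split=> // s; rewrite bv; congr (expi2pi _ *: _).
  rewrite /weight (bigD1 j)//= !mxE !eqxx mulr1 big1 ?addr0.
    by rewrite mulrCA mulfV ?mulr1// pnatr_eq0; lia.
  by move=> i /negPf ij; rewrite !mxE ij andbF mulr0 mul0r.
have Pnat (m : nat) j : P (m%:Z *: delta_mx 0 j).
  elim: m => [|m IH]; first by rewrite scale0r.
  by rewrite intS scalerDl scale1r; apply: PD.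
move=> l; rewrite -/(P l) [l]row_sum_delta.
elim/big_rec: _ => // i x _ Px; apply: PD => //.
by case: (l 0 i) => m; [|rewrite NegzE scaleNr; apply: PN]; exact: Pnat.
Qed.

Lemma sys_period (s : 'rV[int]_n) x :
  (forall j x, beta (N%:R *: delta_mx 0 j : 'rV[R]_n) x = x) ->
  beta (map_mx intr (N%:Z *: s) : 'rV[R]_n) x = x.
Proof.
move=> period.
pose P (l : 'rV[R]_n) := forall x, beta l x = x.
have P0 : P 0 by move=> y; exact: sys0.
have PD l l' : P l -> P l' -> P (l + l') by move=> Pl Pl' y; rewrite sysD Pl' Pl.
have PN l : P l -> P (- l).
  by move=> Pl y; rewrite -[in LHS](Pl y) -sysD addNr sys0.
have Pnat (m : nat) j : P (m%:R *: (N%:R *: delta_mx 0 j)).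
  elim: m => [|m IH]; first by rewrite scale0r.
  by rewrite -natr1 scalerDl scale1r; apply: PD => //; exact: period.
suff : P (map_mx intr (N%:Z *: s)) by apply.
have -> : map_mx intr (N%:Z *: s) =
    \sum_j (s 0 j)%:~R *: (N%:R *: delta_mx 0 j) :> 'rV[R]_n.
  rewrite [LHS]row_sum_delta; apply: eq_bigr => j _.
  by rewrite !mxE rmorphM/= scalerA mulrC.
elim/big_rec: _ => // j y _ Py; apply: PD => //.
by case: (s 0 j) => m; [|rewrite NegzE rmorphN/= scaleNr; apply: PN]; exact: Pnat.
Qed.

Lemma sys_weight_class (s t : 'rV[int]_n) x :
  (forall j x, beta (N%:R *: delta_mx 0 j : 'rV[R]_n) x = x) ->
  weight_class N s = weight_class N t ->
  beta (map_mx intr s : 'rV[R]_n) x = beta (map_mx intr t : 'rV[R]_n) x.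
Proof.
move=> period st; have [|l lP] := @weight_class_eq0 _ _ N1 (s - t).
  by rewrite weight_classD weight_classN st subrr.
rewrite -(subrK t s) lP map_mxD addrC sysD; congr (beta _ _).
exact: sys_period.
Qed.

(** Lifts let the finite group $(\mathbb{Z}/N)^n$ index the automorphisms [beta] at integer
    vectors. *)
Definition class_rep (c : 'rV['Z_N]_n) : 'rV[int]_n :=
  map_mx (fun a : 'Z_N => (val a)%:Z) c.

Lemma class_repK c : weight_class N (class_rep c) = c.
Proof. by apply/rowP => j; rewrite !mxE; exact: natr_Zp. Qed.

End Weights.

(** * The isomorphism of the covering group with $\mathbb{Z}^n/\Gamma$ *)

Theorem lemma4p4 (R : realType) (n : nat) (theta : 'M[R]_n)
    (theta_skew : theta^T = - theta)
    (B : cstarAlg R) (u : 'I_n -> B) (B_torus : quantum_torus theta u)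
    (gamma : cstarSystem B (vecGroup R n)) (gammaP : gauge_action u gamma)
    (A : cstarAlg R) (G : finGroupType)
    (alpha : cstarSystem A (discrete_topology G)) (iota : B -> A)
    (alpha_connected : connected_covering alpha iota gamma)
    (beta : cstarSystem A (vecGroup R n))
    (betaP : connecting_lift alpha iota gamma beta) :
  exists phi : G -> RnMod beta,
    [/\ {morph phi : g h / (g * h)%g >-> g + h},
        set_bij [set: G] (ZnMod beta) phi
      & forall (g : G) (x : A), alpha g x = quot_act beta (phi g) x].
Proof.
have [[alpha_free [iota_lin [iota1 iotaM] iotaS] iota_inj iotaE] _] :=
  alpha_connected.
have [[beta_cpt beta_iota] beta_erg alpha_beta] := betaP.
have [[u_unit _] u_gen _] := B_torus.
have iota_u0 k : iota (u k) != 0.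
  apply/eqP => iu0; have [uu _] := u_unit k.
  have := oner_neq0 A; rewrite -iota1 -uu iotaM iu0 mulr0 eqxx.
  by [].
have beta_u (s : 'rV[R]_n) k : beta s (iota (u k)) = expi2pi (s 0 k) *: iota (u k).
  by rewrite beta_iota gammaP linear_funZ.
(* The kernel is integral: if [beta s] is the identity, it fixes the nonzero [iota (u j)], which it
   multiplies by [expi2pi (s 0 j)]. *)
have [s sP j|N N1 period] := period_exists beta_cpt.
  apply: expi2pi_eq1; apply: (scaler_injl (iota_u0 j)).
  by rewrite -beta_u sP scale1r.
have alphaB b : (range iota) b -> forall g, alpha g b = b by rewrite iotaE.
have weights : forall l : 'rV[int]_n, exists w,
    [/\ range iota w, w != 0 & eigenvector beta N (N%:Z *: l) w].
  apply: (@eigenvector_generated _ _ _ _ _ N1 beta_erg _ (iota \o u)) => //.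
  - by exists 1.
  - by move=> _ _ [x _ <-] [y _ <-]; exists (x * y) => //; rewrite iotaM.
  - by move=> _ [x _ <-]; exists (star x) => //; rewrite iotaS.
pose Hom := module_hom beta (range iota).
have alpha_hom g : Hom (alpha g).
  split; [exact: sys_linear| |exact: sys_continuous|exact: alpha_beta|].
    by have [[]] := sys_act_aut alpha g.
  by move=> x /alphaB.
have beta_int_iota (z : 'rV[int]_n) x :
    range iota x -> beta (map_mx intr z : 'rV[R]_n) x = x.
  by move=> [b _ <-]; rewrite beta_iota (gauge_action_int u_gen gammaP).
have beta_hom (z : 'rV[int]_n) : Hom (beta (map_mx intr z : 'rV[R]_n)).
  split; [exact: sys_linear| |exact: sys_continuous| |exact: beta_int_iota].
    by have [[]] := sys_act_aut beta (map_mx intr z : 'rV[R]_n).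
  by move=> s x; rewrite -!sysD addrC.
have deltaE j : delta_mx 0 j = map_mx intr (delta_mx 0 j : 'rV[int]_n) :> 'rV[R]_n.
  by apply/rowP => i; rewrite !mxE rmorph_nat.
(* Here [S] is [alpha]: the sum of the [alpha g v] lies in the fixed point algebra, that is in the
   torus, where integer vectors act trivially. The element found inverts [beta] at [z], hence the
   passage to [g^-1]. *)
have beta_alpha z :
    exists g, forall x, alpha g x = beta (map_mx intr z : 'rV[R]_n) x.
  have [|g gP] := module_hom_inverse N1 period beta_erg weights
    1%g alpha_hom _ (beta_hom z).
    move=> v j; rewrite deltaE beta_int_iota// iotaE => h /=.
    rewrite linear_fun_sum; last exact: sys_linear.
    rewrite [RHS](reindex_inj (mulgI h)); apply: eq_bigr => g _.
    by rewrite -(sys_actM alpha).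
  exists g^-1%g => x; rewrite -[in LHS](gP x) alpha_beta; congr (beta _ _).
  by rewrite (sys_invK alpha g).
(* The roles are exchanged: [S] is now [beta] on class representatives, and translation by a unit
   vector permutes the classes. *)
have alphaE g :
    exists z, forall x, alpha g x = beta (map_mx intr z : 'rV[R]_n) x.
  have [|c cP] := module_hom_inverse N1 period beta_erg weights (0 : 'rV['Z_N]_n)
      (fun c => beta_hom (class_rep c)) _ (alpha_hom g).
    move=> v j; rewrite linear_fun_sum; last exact: sys_linear.
    rewrite [RHS](reindex_inj (addrI (weight_class N (delta_mx 0 j)))).
    apply: eq_bigr => c _; rewrite -sysD deltaE -map_mxD.
    by apply: (sys_weight_class N1 _ period); rewrite weight_classD !class_repK.
  exists (- class_rep c) => x.
  rewrite -[in RHS](cP x) alpha_beta -sysD -map_mxD addNr.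
  by rewrite (_ : map_mx _ 0 = 0) ?sys0//; apply/rowP => i; rewrite !mxE.
have [z zP] := choice alphaE.
have piE (s t : 'rV[R]_n) :
    beta s =1 beta t -> \pi_(RnMod beta) s = \pi_(RnMod beta) t.
  move=> st; apply/pi_eqP => x.
  by rewrite addrC sysD st -sysD addNr sys0.
(* The class is independent of the chosen [z g], since equal automorphisms have equal classes; this
   gives additivity and, with [beta_alpha], surjectivity. Injectivity is faithfulness of [alpha]. *)
exists (fun g => \pi_(RnMod beta) (map_mx intr (z g))); split.
- move=> g h; rewrite -[RHS]raddfD; apply: piE => x.
  by rewrite -zP sysD -!zP (sys_actM alpha).
- split=> [g _|g h _ _ /pi_eqP gh|y [t _ <-]].
  + by exists (z g).
  + apply: (free_faithful alpha_free) => x; rewrite !zP -[RHS]gh.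
    by rewrite -sysD subrK.
  + have [g gP] := beta_alpha t; exists g => //.
    by apply: piE => x; rewrite -zP gP.
- by move=> g x; rewrite quot_actE zP.
Qed.
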